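(* Let $\sigma\ge1$ and $\mu\ge1/2$. A function $f\in C^\infty(\mathbb{T}^m\times\mathbb{R}^n)\cap L^1(\mathbb{T}^m\times\mathbb{R}^n)$ belongs to $\mathcal{S}_{\sigma,\mu}(\mathbb{T}^m\times\mathbb{R}^n)$ if and only if there exist $C_0,C_1,\varepsilon>0$ such that, for all $\alpha,\beta\in\mathbb{N}_0^n$, $$\sup_{(k,x)\in\mathbb{Z}^m\times\mathbb{R}^n}e^{\varepsilon|k|^{1/\sigma}}|x^\alpha\partial_x^\beta\widehat{f}(k,x)|\leq C_0C_1^{|\alpha+\beta|}(\alpha!\beta!)^{\mu}.$$
   Context: $\mathbb{T}^m=(\mathbb{R}/2\pi\mathbb{Z})^m$. Here $\widehat f(k,x)=\frac1{(2\pi)^m}\int_{[0,2\pi]^m}f(t,x)e^{-ik\cdot t}\,dt$ is the partial Fourier coefficient on the torus. For $C>0$, $\mathcal{S}_{\sigma,\mu,C}(\mathbb{T}^m\times\mathbb{R}^n)$ is the space of $\varphi\in C^\infty(\mathbb{T}^m\times\mathbb{R}^n)$ with $$\sup_{\alpha,\beta\in\mathbb{N}_0^n}\sup_{\gamma\in\mathbb{N}_0^m}C^{-|\alpha+\beta|-|\gamma|}\gamma!^{-\sigma}(\alpha!\beta!)^{-\mu}\sup_{(t,x)}|x^\alpha\partial_x^\beta\partial_t^\gamma\varphi(t,x)|<\infty,$$ and $\mathcal{S}_{\sigma,\mu}(\mathbb{T}^m\times\mathbb{R}^n)=\bigcup_{C>0}\mathcal{S}_{\sigma,\mu,C}(\mathbb{T}^m\times\mathbb{R}^n)$.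 *)

(* Defs.v *)
From HB Require Import structures.
From mathcomp Require Import all_boot all_order all_algebra.
From mathcomp Require Import complex.
From mathcomp Require Import all_classical all_reals all_analysis.

Set Implicit Arguments.
Unset Strict Implicit.
Unset Printing Implicit Defensive.

Import Order.TTheory GRing.Theory Num.Theory.
Import numFieldNormedType.Exports.

Local Open Scope classical_set_scope.
Local Open Scope complex_scope.
Local Open Scope ring_scope.

(* Lebesgue measure on R^n, carried by the product (= Borel) sigma-algebra of
   [n.-tuple R], built as the iterated product of [lebesgue_measure]. *)

Section lebesgue_cons.
Context (R : realType) (n : nat).
Local Notation mR := (measurableTypeR R).

Definition cons_pair (p : mR * n.-tuple mR) : n.+1.-tuple mR :=
  [tuple of p.1 :: p.2].

Lemma measurable_cons_pair : measurable_fun [set: mR * n.-tuple mR] cons_pair.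
Proof. exact: (measurable_cons measurable_fst measurable_snd). Qed.

Variable mu : {sigma_finite_measure set (n.-tuple mR) -> \bar R}.

Definition lebesgue_cons : set (n.+1.-tuple mR) -> \bar R :=
  pushforward (lebesgue_measure \x mu)%E cons_pair.

Let lebesgue_cons0 : lebesgue_cons set0 = 0%E.
Proof. by rewrite /lebesgue_cons /pushforward preimage_set0 measure0. Qed.

Let lebesgue_cons_ge0 A : (0 <= lebesgue_cons A)%E.
Proof. by rewrite /lebesgue_cons /pushforward measure_ge0. Qed.

Let lebesgue_cons_sigma_additive : semi_sigma_additive lebesgue_cons.
Proof.
move=> F mF tF mUF; rewrite /lebesgue_cons /pushforward preimage_bigcup.
have mcons := measurable_cons_pair.
apply: measure_semi_sigma_additive.
- by move=> i; rewrite -[X in measurable X]setTI; exact: mcons.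
- apply/trivIsetP => /= i j _ _ ij; rewrite -preimage_setI.
  by move/trivIsetP : tF => /(_ _ _ _ _ ij) ->//; rewrite preimage_set0.
- by rewrite -preimage_bigcup -[X in measurable X]setTI; exact: mcons.
Qed.

HB.instance Definition _ := isMeasure.Build _ _ _ lebesgue_cons
  lebesgue_cons0 lebesgue_cons_ge0 lebesgue_cons_sigma_additive.

Let lebesgue_cons_sigma_finite : sigma_finite setT lebesgue_cons.
Proof.
have /sigma_finiteP[F [TF ndF Foo]] := sigma_finiteT (@lebesgue_measure R).
have /sigma_finiteP[G [TG ndG Goo]] := sigma_finiteT mu.
pose H i := F i `*` G i.
have UH : [set: mR * n.-tuple mR] = \bigcup_i H i.
  rewrite -setXTT TF TG predeqE => -[x y]; split.
    move=> [/= [k _ Fkx] [l _ Gly]]; exists (maxn k l) => //; split.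
    - by move: x Fkx; exact/subsetPset/ndF/leq_maxl.
    - by move: y Gly; exact/subsetPset/ndG/leq_maxr.
  by move=> [k _ []/= ? ?]; split; exists k.
pose uncons (z : n.+1.-tuple mR) : mR * n.-tuple mR :=
  (thead z, [tuple of behead z]).
have consK : cancel cons_pair uncons.
  move=> [a t]; rewrite /uncons /cons_pair /=; congr pair.
  exact/val_inj.
have muncons : measurable_fun setT uncons.
  apply: measurable_fun_pair; first exact: measurable_tnth.
  exact: measurable_behead.
exists (fun i => uncons @^-1` H i); first by rewrite -preimage_bigcup -UH.
move=> i; have [mFi Fi] := Foo i; have [mGi Gi] := Goo i.
have mHi : measurable (H i) by exact: measurableX.
split; first by rewrite -[X in measurable X]setTI; exact: muncons.
rewrite /lebesgue_cons /pushforward.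
have -> : cons_pair @^-1` (uncons @^-1` H i) = H i.
  by apply/seteqP; split=> p /=; rewrite consK.
by rewrite product_measure1E// lte_mul_pinfty// ge0_fin_numE.
Qed.

HB.instance Definition _ := Measure_isSigmaFinite.Build _ _ _ lebesgue_cons
  lebesgue_cons_sigma_finite.

End lebesgue_cons.

Fixpoint lebesgue_tuple (R : realType) (n : nat) :
    {sigma_finite_measure set (n.-tuple (measurableTypeR R)) -> \bar R} :=
  match n with
  | 0 => dirac [tuple]
  | n'.+1 => lebesgue_cons (lebesgue_tuple R n')
  end.

Section multi_indices.

Definition midx_abs n (a : 'rV[nat]_n) : nat := (\sum_i a ord0 i)%N.

Definition midx_fact n (a : 'rV[nat]_n) : nat := (\prod_i (a ord0 i)`!)%N.

Definition monom (R : realType) n (x : 'rV[R]_n) (a : 'rV[nat]_n) : R :=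
  \prod_i x 0 i ^+ a ord0 i.

(* The norm |k| of the library on row vectors is the sup norm. *)
Definition eucl_norm (R : realType) n (x : 'rV[R]_n) : R :=
  Num.sqrt (\sum_i x 0 i ^+ 2).

End multi_indices.

(* [R[i]] carries no topology over the real field [R] in the library, so
   limits, derivatives and integrals of complex-valued functions are taken on
   the real and imaginary parts. *)
Section complex_calculus.
Context (R : realType) (V : normedModType R).
Implicit Types (g : V -> R[i]) (v : V).

Definition cderivable g v : Prop := forall p,
  derivable (fun q => complex.Re (g q)) p v /\
  derivable (fun q => complex.Im (g q)) p v.

(* Junk value when [g] is not [cderivable] in the direction [v]. *)
Definition cderive v g : V -> R[i] := fun p =>
  ('D_v (fun q => complex.Re (g q)) p) +i* ('D_v (fun q => complex.Im (g q)) p).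

Definition ccontinuous g : Prop :=
  continuous (fun q => complex.Re (g q)) /\
  continuous (fun q => complex.Im (g q)).

(* D_{e_0}^{b_0} ... D_{e_{n-1}}^{b_{n-1}} g *)
Definition mderive n (e : 'I_n -> V) (b : 'rV[nat]_n) g : V -> R[i] :=
  foldr (fun i h => iter (b ord0 i) (cderive (e i)) h) g (enum 'I_n).

(* All partial derivatives along the family [e], of every order and in every
   order of differentiation, exist and are continuous. *)
Definition smooth_along (I : Type) (e : I -> V) g : Prop :=
  forall s : seq I, let h := foldr (fun i => cderive (e i)) g s in
    ccontinuous h /\ forall i, cderivable h (e i).

End complex_calculus.

Section torus.
Context (R : realType) (m n : nat).

(* Functions on T^m x R^n are handled as functions on R^m x R^n that are
   2 pi-periodic in each of the first m variables. *)
Local Notation dom := ('rV[R]_m * 'rV[R]_n)%type.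
Implicit Types (f : dom -> R[i]).

Definition dir_t (j : 'I_m) : dom := (delta_mx 0 j, 0).
Definition dir_x (i : 'I_n) : dom := (0, delta_mx 0 i).
Definition dir (i : 'I_m + 'I_n) : dom :=
  match i with inl j => dir_t j | inr i => dir_x i end.

Definition periodic_t f : Prop :=
  forall (j : 'I_m) (p : dom), f (p + (2 * pi) *: dir_t j) = f p.

Definition smooth_torus : set (dom -> R[i]) :=
  [set f | periodic_t f /\ smooth_along dir f].

Definition row_of_tuple k (t : k.-tuple (measurableTypeR R)) : 'rV[R]_k :=
  \row_i tnth t i.

Definition cube : set (m.-tuple (measurableTypeR R)) :=
  [set t | forall i, 0 <= tnth t i <= 2 * pi].

Definition L1_torus : set (dom -> R[i]) :=
  [set f | let mu := (lebesgue_tuple R m \x lebesgue_tuple R n)%E in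
    let D := cube `*` [set: n.-tuple (measurableTypeR R)] in
    mu.-integrable D
      (fun p => (complex.Re (f (row_of_tuple p.1, row_of_tuple p.2)))%:E) /\
    mu.-integrable D
      (fun p => (complex.Im (f (row_of_tuple p.1, row_of_tuple p.2)))%:E)].

Definition cexpi (u : R) : R[i] := cos u +i* sin u.

Definition int_vec (k : 'rV[int]_m) : 'rV[R]_m := map_mx intr k.

Definition dotp (k t : 'rV[R]_m) : R := \sum_j k 0 j * t 0 j.

Definition fourier_coef f (k : 'rV[int]_m) (x : 'rV[R]_n) : R[i] :=
  let F t :=
    f (row_of_tuple t, x) * cexpi (- dotp (int_vec k) (row_of_tuple t)) in
  ((2 * pi) ^- m)%:C *
  ((\int[lebesgue_tuple R m]_(t in cube) complex.Re (F t)) +i*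
   (\int[lebesgue_tuple R m]_(t in cube) complex.Im (F t))).

Definition GS_space_const (sigma mu C : R) : set (dom -> R[i]) :=
  [set f | smooth_torus f /\
    (ereal_sup (range (fun abc : 'rV[nat]_n * 'rV[nat]_n * 'rV[nat]_m =>
       let: (a, b, c) := abc in
       (C ^- (midx_abs (a + b) + midx_abs c)
          * ((midx_fact c)%:R `^ (- sigma))
          * ((midx_fact a * midx_fact b)%:R `^ (- mu)))%:E *
       ereal_sup (range (fun p : dom =>
         (Normc.normc ((monom p.2 a)%:C *
            mderive dir_x b (mderive dir_t c f) p))%:E)))) < +oo)%E].

Definition GS_space (sigma mu : R) : set (dom -> R[i]) :=
  \bigcup_(C in [set C | 0 < C]) GS_space_const sigma mu C.

End torus.

(* Main.v *)
Require Import Defs.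
From HB Require Import structures.
From mathcomp Require Import all_boot all_order all_algebra.
From mathcomp Require Import complex.
From mathcomp Require Import all_classical all_reals all_analysis.
From mathcomp Require Import measurable_realfun ring lra.

Import Order.TTheory GRing.Theory Num.Theory.
Import numFieldNormedType.Exports.

Local Open Scope classical_set_scope.
Local Open Scope complex_scope.
Local Open Scope ring_scope.

(** Why the theorem holds.  Write D = x^a d_x^b d_t^c f.

    Both directions rest on one identity, [fourier_coef_mderive]: the k-th
    Fourier coefficient of d_x^b d_t^c f is (ik)^c times d_x^b of the k-th
    Fourier coefficient of f.  The t-derivatives contribute ik_j because the
    integral over a period of the j-th derivative of a periodic function is 0
    ([cubeint_derive_eq0], by Fubini and the fundamental theorem of calculus);
    the x-derivatives pass through the integral by dominated convergence, the
    integrand being continuous on a compact cube ([derive_cubeint]).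

    From the Gelfand-Shilov estimates to the exponential decay: let Q be the
    modulus of x^a d_x^b of the k-th coefficient of f.  A sup bound on D bounds
    the moment |k^c| Q.  Taking c = N e_j for the largest coordinate k_j gives
    |k_j|^N Q <= B C^N N!^sigma for every N, and summing the exponential series
    turns these moments into the decay exp(eps |k|^(1/sigma)) Q <= 2^sigma B
    ([expR_decay_of_moments]).

    From the decay to the estimates: conversely |k_j|^(c_j) is bounded by
    K L^(c_j) c_j!^sigma exp(delta |k_j|^(1/sigma)) / ((|k_j|+1)(|k_j|+2))
    ([moments_of_expR_decay]), so the coefficients of D are bounded by a
    constant A of the right size times a product of summable weights w(k_j).
    It remains to bound D by its Fourier coefficients, pointwise.  No Fourier
    inversion is needed: integrate D against the product Fejer kernel, a
    nonnegative trigonometric polynomial, and divide by its mass.  The result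
    is at most A W^m, where W bounds the sums of the weight, and it tends to
    the value of D by Korovkin's argument: a continuous periodic function G
    satisfies, for any eta > 0 and some C,
      G(u) - G(v) <= eta + C sum_j (1 - cos (v_j - u_j))
    on the period cube, and the normalized kernel integrates the sum to O(1/N)
    ([korovkin_modulus], [ler_of_fourier]).  The estimate is proved for real
    functions and applied to the real and imaginary parts of D; this only
    costs a factor 2. *)

Set Implicit Arguments.
Unset Strict Implicit.
Unset Printing Implicit Defensive.

(** * Measurability of continuous functions on tuples *)

Section measurability.
Context (R : realType).

(** The point k/(N + 1) of the grid of step 1/(N + 1). *)
Let grid (m N : nat) (k : 'rV[int]_m) : 'rV[R]_m :=
  \row_i ((k ord0 i)%:~R / N.+1%:R).

(** The index of the grid point just below [t], coordinate by coordinate. *)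
Let grid_floor (m N : nat) (t : m.-tuple (measurableTypeR R)) : 'rV[int]_m :=
  \row_i Num.floor (N.+1%:R * tnth t i).

Lemma measurable_preimage_grid_floor (m N : nat) (k : 'rV[int]_m) :
  measurable [set t | @grid_floor m N t = k].
Proof.
have -> : [set t | @grid_floor m N t = k] =
    \bigcap_(i in [set: 'I_m])
      ((fun t : m.-tuple (measurableTypeR R) => N.+1%:R * tnth t i) @^-1`
         `[(k ord0 i)%:~R, (k ord0 i + 1)%:~R[%classic).
  apply/seteqP; split => t /=.
    by move=> <- i _ /=; rewrite in_itv/= mxE Num.Theory.floor_le floorD1_gt.
  move=> tk; apply/rowP => i; rewrite mxE.
  by apply: floor_def; have := tk i Logic.I; rewrite /= in_itv.
apply: fin_bigcap_measurable => [|i _]; first exact: finite_finset.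
rewrite -[X in measurable X]setTI.
have mf : measurable_fun [set: m.-tuple (measurableTypeR R)]
   (fun t : m.-tuple (measurableTypeR R) => N.+1%:R * tnth t i : R).
  apply: measurable_funM; first exact: measurable_cst.
  exact: measurable_tnth.
exact: mf.
Qed.

Lemma cvg_rV (T : Type) (F : set_system T) {FF : Filter F} n
    (f : T -> 'rV[R]_n) (v : 'rV[R]_n) :
  (forall i, f x 0 i @[x --> F] --> v 0 i) -> f x @[x --> F] --> v.
Proof.
move=> fv; apply/cvgrPdist_le => e e0; near=> x.
rewrite [leLHS]/Num.norm/= mx_normrE; apply: bigmax_le; first exact: ltW.
move=> [i j] _ /=; rewrite (ord1 i) !mxE; move: j {i}.
near: x; apply: filter_forall => j.
by have /cvgrPdist_le/(_ _ e0) := fv j.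
Unshelve. all: by end_near. Qed.

Lemma cvg_grid_floor m (t : m.-tuple (measurableTypeR R)) :
  grid N (grid_floor N t) @[N --> \oo] --> row_of_tuple t.
Proof.
apply: cvg_rV => i; apply/cvgrPdist_lt => e e0.
have : N.+1%:R^-1 @[N --> \oo] --> (0 : R) by exact: cvg_harmonic.
move/cvgr0_norm_lt => /(_ _ e0); apply: filterS => N.
rewrite ger0_norm ?invr_ge0// => Ne; rewrite !mxE.
apply: le_lt_trans Ne.
set x := tnth t i : R; set y := N.+1%:R.
have y0 : 0 < y :> R by rewrite ltr0n.
have -> : x - (Num.floor (y * x))%:~R / y = (y * x - (Num.floor (y * x))%:~R) / y.
  by rewrite mulrBl (mulrC y) mulfK ?gt_eqF//.
have h1 := Num.Theory.floor_le (y * x); have h2 := floorD1_gt (y * x).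
rewrite ger0_norm ?divr_ge0 ?subr_ge0 ?(ltW y0)//.
rewrite -[leRHS]mul1r ler_pM2r ?invr_gt0// lerBlDl.
by rewrite -[X in _ + X]/(1%:~R) -intrD ltW.
Qed.

(** A continuous function is the pointwise limit of its values at the points
    of the grids (1/(N + 1))Z^m; each approximant takes countably many values, on
    boxes of the product sigma-algebra. *)
Lemma measurable_row_of_tuple m (G : 'rV[R]_m -> R) : continuous G ->
  measurable_fun [set: m.-tuple (measurableTypeR R)] (G \o @row_of_tuple R m).
Proof.
move=> cG.
apply: (@measurable_fun_cvg _ _ _ _ (fun N => G \o grid N \o grid_floor N)) => [N|t _].
  move=> _ Y mY; rewrite setTI.
  have -> : (G \o grid N \o @grid_floor m N) @^-1` Y =
     \bigcup_(k in [set: 'rV[int]_m])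
        ([set t | grid_floor N t = k] `&` [set t | Y (G (grid N k))]).
    apply/seteqP; split => [t Yt|t [k _ [<-]]//].
    by exists (grid_floor N t).
  apply: countable_bigcupT_measurable; first exact: countableP.
  move=> k; apply: measurableI; first exact: measurable_preimage_grid_floor.
  have [Yk|Yk] := pselect (Y (G (grid N k))).
    by rewrite (_ : [set _ | _] = setT)//; apply/seteqP; split.
  by rewrite (_ : [set _ | _] = set0)//; apply/seteqP; split.
apply: (@cvg_comp _ _ _ (fun N => grid N (grid_floor N t)) G).
  exact: cvg_grid_floor.
exact: cG.
Qed.
End measurability.

(** * Integration over the period cube *)

Lemma continuous_sumr {R : realType} (T : topologicalType) (I : Type) (r : seq I)
    (G : I -> T -> R) : (forall i, continuous (G i)) ->
  continuous (fun v => \sum_(i <- r) G i v).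
Proof.
move=> cG; elim: r => [|i r IH] v.
  have -> : (fun v => \sum_(i <- [::]) G i v) = cst 0.
    by apply/funext => w; rewrite big_nil.
  exact: cst_continuous.
have -> : (fun v => \sum_(j <- i :: r) G j v) =
    (fun v => G i v + \sum_(j <- r) G j v).
  by apply/funext => w; rewrite big_cons.
by apply: cvgD; [exact: cG|exact: IH].
Qed.

Section row_cons.
Context {R : realType}.

(** The row vector with first coordinate [s] followed by [v]. *)
Definition row_cons m (s : R) (v : 'rV[R]_m) : 'rV[R]_m.+1 :=
  \row_i oapp (fun j => v ord0 j) s (unlift ord0 i).

Lemma row_cons0 m s (v : 'rV[R]_m) : row_cons s v ord0 ord0 = s.
Proof. by rewrite mxE unlift_none. Qed.

Lemma row_consS m s (v : 'rV[R]_m) j : row_cons s v ord0 (lift ord0 j) = v ord0 j.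
Proof. by rewrite mxE liftK. Qed.

Lemma row_consP m (u w : 'rV[R]_m.+1) : u ord0 ord0 = w ord0 ord0 ->
  (forall j, u ord0 (lift ord0 j) = w ord0 (lift ord0 j)) -> u = w.
Proof.
move=> h0 hS; apply/rowP => i.
by case: (unliftP ord0 i) => [j ->|->]; [exact: hS|exact: h0].
Qed.

Lemma row_cons_shift0 m s h (v : 'rV[R]_m) :
  row_cons (h + s) v = h *: delta_mx 0 ord0 + row_cons s v.
Proof.
apply: row_consP => [|j]; rewrite !mxE ?unlift_none ?liftK/= ?mulr1//.
by rewrite mulr0 add0r.
Qed.

Lemma row_cons_shiftS m s (u v : 'rV[R]_m) (h : R) (j : 'I_m) :
  row_cons s (h *: delta_mx 0 j + v) =
  h *: delta_mx 0 (lift ord0 j) + row_cons s v.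
Proof.
apply: row_consP => [|i]; rewrite !mxE ?unlift_none ?liftK/= ?mxE.
  by rewrite mulr0 add0r.
by rewrite (inj_eq lift_inj).
Qed.

Lemma continuous_row_cons_head m (v : 'rV[R]_m) : continuous (fun s => row_cons s v).
Proof.
move=> s; apply: cvg_rV => i; case: (unliftP ord0 i) => [j ->|->].
  under eq_fun do rewrite row_consS.
  by rewrite row_consS; exact: cvg_cst.
under eq_fun do rewrite row_cons0.
by rewrite row_cons0; exact: cvg_id.
Qed.

Lemma continuous_row_cons_tail m s : continuous (@row_cons m s).
Proof.
move=> v; apply: (cvg_rV (FF := nbhs_filter v)) => i; case: (unliftP ord0 i) => [j ->|->].
  under eq_fun do rewrite row_consS.
  by rewrite row_consS; exact: coord_continuous.
under eq_fun do rewrite row_cons0.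
by rewrite row_cons0; exact: cvg_cst.
Qed.

Lemma row_of_tuple_cons m s (t : m.-tuple (measurableTypeR R)) :
  row_of_tuple (cons_pair (s, t)) = row_cons s (row_of_tuple t).
Proof.
apply: row_consP => [|j]; first by rewrite row_cons0 mxE.
by rewrite row_consS !mxE tnthS.
Qed.

End row_cons.

Section cube_integral.
Context {R : realType}.
Local Notation mR := (measurableTypeR R).
Local Notation leb := (@lebesgue_measure R).

Lemma twopi_gt0 : 0 < 2 * pi :> R.
Proof. by rewrite mulr_gt0 ?pi_gt0. Qed.

Lemma lebesgue_segment : leb `[0, 2 * pi]%classic = (2 * pi)%:E.
Proof. by rewrite lebesgue_measure_itv/= lte_fin twopi_gt0 -EFinB subr0. Qed.

Lemma measurable_cube m : measurable (@cube R m).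
Proof.
have -> : @cube R m = \bigcap_(i in [set: 'I_m])
    ((fun t : m.-tuple mR => tnth t i) @^-1` `[0, 2 * pi]%classic).
  apply/seteqP; split => t /=.
    by move=> ct i _ /=; rewrite in_itv/=.
  by move=> h i; have := h i Logic.I; rewrite /= in_itv.
apply: fin_bigcap_measurable => [|i _]; first exact: finite_finset.
rewrite -[X in measurable X]setTI.
exact: measurable_tnth.
Qed.

Lemma preimage_cube_cons m :
  @cons_pair R m @^-1` @cube R m.+1 = `[0, 2 * pi]%classic `*` @cube R m.
Proof.
apply/seteqP; split => -[s t] /=.
  move=> ct; split => [|i /=]; first by have := ct ord0; rewrite in_itv/=.
  by have := ct (lift ord0 i); rewrite tnthS.
rewrite in_itv/= => -[s2 ct] i; case: (unliftP ord0 i) => [j ->|->//].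
by rewrite tnthS; exact: ct.
Qed.

Lemma lebesgue_tuple_cube m :
  lebesgue_tuple R m (@cube R m) = ((2 * pi) ^+ m)%:E.
Proof.
elim: m => [|m IH].
  rewrite /= diracE expr0 mem_set//= => i; by case: i.
rewrite [LHS]/= /lebesgue_cons /pushforward preimage_cube_cons.
rewrite product_measure1E ?IH//; last exact: measurable_cube.
by rewrite [X in (X * _)%E]lebesgue_segment -EFinM exprS.
Qed.

(** Integral over the cube [0, 2pi]^m of a function of row vectors. *)
Definition cubeint m (G : 'rV[R]_m -> R) : R :=
  \int[lebesgue_tuple R m]_(t in @cube R m) G (row_of_tuple t).

(** The same cube as a set of row vectors, compact for their topology. *)
Definition box m : set 'rV[R]_m := [set v | forall i, 0 <= v ord0 i <= 2 * pi].

Lemma compact_box m : compact (@box m).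
Proof.
have -> : @box m = [set v | forall i, `[0, 2 * pi]%classic (v ord0 i)].
  by apply/seteqP; split => v /= bv i; have := bv i; rewrite in_itv.
by apply: (@rV_compact R m (fun=> `[0, 2 * pi]%classic)) => i; exact: segment_compact.
Qed.

Lemma box_row_of_tuple m (t : m.-tuple mR) : cube t -> box (row_of_tuple t).
Proof. by move=> ct i; rewrite mxE; exact: ct. Qed.

Lemma bounded_box m (G : 'rV[R]_m -> R) : continuous G ->
  exists2 M, 0 <= M & forall v, box v -> `|G v| <= M.
Proof.
move=> cG; have /compact_bounded[M [_ bM]] : compact (G @` @box m).
  by apply: continuous_compact; [exact: continuous_subspaceT|exact: compact_box].
exists (`|M| + 1) => [|v bv]; first by rewrite addr_ge0.
by apply: bM; [rewrite ltr_pwDr// ler_norm|exists v].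
Qed.

Lemma integrable_cube m (G : 'rV[R]_m -> R) : continuous G ->
  (lebesgue_tuple R m).-integrable (@cube R m)
    (EFin \o (fun t => G (row_of_tuple t))).
Proof.
move=> cG; apply: measurable_bounded_integrable => //.
- exact: measurable_cube.
- by rewrite [X in (X < _)%E]lebesgue_tuple_cube ltry.
- by apply: measurable_funTS; exact: measurable_row_of_tuple.
- have [M M0 bM] := bounded_box cG; exists M; split; first exact: num_real.
  move=> x Mx t /= /box_row_of_tuple bt.
  by rewrite (le_trans (bM _ bt))// ltW.
Qed.

Lemma cubeint_cst m (c : R) : cubeint (fun _ : 'rV[R]_m => c) = c * (2 * pi) ^+ m.
Proof. rewrite /cubeint Rintegral_cst; last exact: measurable_cube.
by congr GRing.mul; rewrite [X in fine X]lebesgue_tuple_cube. Qed.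

Lemma cubeintD m (F G : 'rV[R]_m -> R) : continuous F -> continuous G ->
  cubeint (fun v => F v + G v) = cubeint F + cubeint G.
Proof.
by move=> cF cG; rewrite /cubeint RintegralD//; first exact: measurable_cube;
  exact: integrable_cube.
Qed.

Lemma cubeintZ m (c : R) (G : 'rV[R]_m -> R) : continuous G ->
  cubeint (fun v => c * G v) = c * cubeint G.
Proof.
by move=> cG; rewrite /cubeint RintegralZl//; first exact: measurable_cube;
  exact: integrable_cube.
Qed.

Lemma ler_cubeint m (F G : 'rV[R]_m -> R) : continuous F -> continuous G ->
  (forall v, box v -> F v <= G v) -> cubeint F <= cubeint G.
Proof.
move=> cF cG FG; apply: le_Rintegral.
- exact: measurable_cube.
- exact: integrable_cube.
- exact: integrable_cube.
- by move=> t /box_row_of_tuple; exact: FG.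
Qed.

Lemma ler_norm_cubeint m (G : 'rV[R]_m -> R) M : continuous G ->
  (forall v, box v -> `|G v| <= M) -> `|cubeint G| <= M * (2 * pi) ^+ m.
Proof.
move=> cG GM; rewrite -(cubeint_cst m M) ler_norml.
have cM : continuous (fun _ : 'rV[R]_m => M) by exact: cst_continuous.
rewrite -mulN1r -cubeintZ//; apply/andP; split; apply: ler_cubeint => //.
- by move=> ?; exact: cst_continuous.
- by move=> v /GM; rewrite ler_norml mulN1r => /andP[].
- by move=> v /GM; rewrite ler_norml => /andP[].
Qed.

Lemma cubeint_sum m (I : Type) (r : seq I) (G : I -> 'rV[R]_m -> R) :
  (forall i, continuous (G i)) ->
  cubeint (fun v => \sum_(i <- r) G i v) = \sum_(i <- r) cubeint (G i).
Proof.
move=> cG; elim: r => [|i r IH].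
  rewrite big_nil; under [X in cubeint X]eq_fun do rewrite big_nil.
  by rewrite cubeint_cst mul0r.
rewrite big_cons -IH -cubeintD//; last first.
  exact: continuous_sumr.
by congr cubeint; apply/funext => v; rewrite big_cons.
Qed.

Section fubini.
Context (m : nat) (G : 'rV[R]_m.+1 -> R) (cG : continuous G).

Let rect : set (mR * m.-tuple mR) := `[0, 2 * pi]%classic `*` @cube R m.
Let g (p : mR * m.-tuple mR) : \bar R :=
  (G (row_cons p.1 (row_of_tuple p.2)))%:E.

Let g_cons : g = EFin \o (fun t => G (row_of_tuple t)) \o @cons_pair R m.
Proof. by apply/funext => -[s t]; rewrite /= row_of_tuple_cons. Qed.

Let measurable_rect : measurable rect.
Proof. by apply: measurableX => //; exact: measurable_cube. Qed.

Let integrable_g : (leb \x lebesgue_tuple R m)%E.-integrable rect g.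
Proof.
apply: measurable_bounded_integrable => //.
- rewrite [X in (X < _)%E]product_measure1E//; last exact: measurable_cube.
  rewrite lebesgue_tuple_cube [X in (X * _)%E]lebesgue_segment.
  by rewrite -EFinM ltry.
- apply: measurable_funTS.
  have := measurableT_comp (measurable_row_of_tuple cG) (@measurable_cons_pair R m).
  by congr measurable_fun; apply/funext => -[s t]; rewrite /= row_of_tuple_cons.
- have [M M0 bM] := bounded_box cG; exists M; split; first exact: num_real.
  move=> x Mx [s t] ct; apply: le_trans (ltW Mx); apply: bM.
  rewrite -row_of_tuple_cons; apply: box_row_of_tuple.
  by move: ct; rewrite /rect -preimage_cube_cons.
Qed.

Let cubeintE : (cubeint G)%:E =
  (\int[leb \x lebesgue_tuple R m]_p (g \_ rect) p)%E.
Proof.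
rewrite /cubeint /Rintegral fineK; last first.
  by apply: integrable_fin_num; [exact: measurable_cube|exact: integrable_cube].
rewrite -integral_mkcond g_cons /rect -preimage_cube_cons.
rewrite -integral_pushforward//.
- exact: measurable_cons_pair.
- apply/measurable_EFinP; exact: measurable_row_of_tuple.
- by rewrite preimage_cube_cons -g_cons.
- exact: measurable_cube.
Qed.

Let integrable_rect : (leb \x lebesgue_tuple R m)%E.-integrable setT (g \_ rect).
Proof. by have := integrable_g; rewrite integrable_mkcond. Qed.

(** Fubini, in the only form used: the integral over the cube vanishes as
    soon as the partial integrals do, in the first variable here and in the
    remaining ones in [cubeint_eq0_tail]. *)
Lemma cubeint_eq0_head :
  (forall v, \int[leb]_(s in `[0%R, (2 * pi)%R]) (G (row_cons s v))%:E = 0)%E ->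
  cubeint G = 0.
Proof.
move=> G0; apply: EFin_inj; rewrite cubeintE -integral21_prod_meas1//.
apply: integral0_eq => t _; rewrite /fubini_G.
have [ct|ct] := pselect (cube t).
  rewrite -(G0 (row_of_tuple t)) [RHS]integral_mkcond.
  apply: eq_integral => s _; rewrite /patch.
  by congr (if _ then _ else _); apply/idP/idP; rewrite !inE => // -[].
apply: integral0_eq => s _; rewrite /patch; case: ifPn => //.
by rewrite inE => -[_ /ct].
Qed.

Lemma cubeint_eq0_tail :
  (forall s, cubeint (fun v => G (row_cons s v)) = 0) -> cubeint G = 0.
Proof.
move=> G0; apply: EFin_inj; rewrite cubeintE -integral12_prod_meas1//.
apply: integral0_eq => s _; rewrite /fubini_F.
have [cs|cs] := pselect (`[0, 2 * pi]%classic s).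
  have cGs : continuous (fun v => G (row_cons s v)).
    move=> v; apply: (@continuous_comp _ _ _ (row_cons s)).
      exact: continuous_row_cons_tail.
    exact: cG.
  transitivity ((cubeint (fun v => G (row_cons s v)))%:E); last by rewrite G0.
  rewrite /cubeint /Rintegral fineK; last first.
    apply: integrable_fin_num; last exact: (integrable_cube cGs).
    exact: measurable_cube.
  rewrite [RHS]integral_mkcond.
  apply: eq_integral => t _; rewrite /patch.
  by congr (if _ then _ else _); apply/idP/idP; rewrite !inE => // -[].
apply: integral0_eq => t _; rewrite /patch; case: ifPn => //.
by rewrite inE => -[/cs].
Qed.

End fubini.
End cube_integral.

(** * Derivatives and integrals over the period cube *)

Lemma continuous_pair (S T U : topologicalType) (f : S -> T) (g : S -> U) :
  continuous f -> continuous g -> continuous (fun x => (f x, g x)).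
Proof.
move=> cf cg x.
by apply: (@cvg_pair _ _ _ _ (nbhs (f x)) (nbhs (g x))); [exact: cf|exact: cg].
Qed.

Section line_derivative.
Context {R : realType} {V : normedModType R}.
Implicit Types (g : V -> R) (x w : V).

Let quotient_line g x w (h : R) :
  (fun k : R => k^-1 *: (g ((k *: 1 + h) *: w + x) - g (h *: w + x))) =
  (fun k : R => k^-1 *: (g (k *: w + (h *: w + x)) - g (h *: w + x))).
Proof.
by apply/funext => k; rewrite scalerDl addrA [k *: (1 : R)]mulr1.
Qed.

Lemma derivable_line g x w (h : R) : derivable g (h *: w + x) w ->
  derivable (fun k : R => g (k *: w + x)) h 1.
Proof. by rewrite /derivable /= quotient_line. Qed.

Lemma derive_line g x w (h : R) :
  derive1 (fun k : R => g (k *: w + x)) h = 'D_w g (h *: w + x).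
Proof. by rewrite derive1E /derive /= quotient_line. Qed.

End line_derivative.

Section cubeint_derive.
Context {R : realType}.

(** By induction on the dimension: either the derivative is in the first
    variable, and the inner integral vanishes by the fundamental theorem of
    calculus and periodicity, or the induction hypothesis applies to the
    remaining variables. *)
Lemma cubeint_derive_eq0 m (j : 'I_m) (phi : 'rV[R]_m -> R) :
  continuous phi ->
  (forall v, derivable phi v (delta_mx 0 j)) ->
  continuous (fun v => 'D_(delta_mx 0 j) phi v) ->
  (forall v, phi (v + (2 * pi) *: delta_mx 0 j) = phi v) ->
  cubeint (fun v => 'D_(delta_mx 0 j) phi v) = 0.
Proof.
elim: m j phi => [[]//|m IH] j phi cphi dphi cD per.
case: (unliftP ord0 j) => [i ji|j0].
  apply: cubeint_eq0_tail => // s; subst j.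
  pose psi v := phi (row_cons s v).
  have quot v : (fun k : R => k^-1 *: (psi (k *: delta_mx 0 i + v) - psi v)) =
    (fun k : R => k^-1 *: (phi (k *: delta_mx 0 (lift ord0 i) + row_cons s v)
       - phi (row_cons s v))).
    by apply/funext => k; rewrite /psi row_cons_shiftS.
  have Dpsi : (fun v => 'D_(delta_mx 0 i) psi v) =
      (fun v => 'D_(delta_mx 0 (lift ord0 i)) phi (row_cons s v)).
    by apply/funext => v; rewrite /derive quot.
  rewrite -Dpsi; apply: IH.
  - move=> v; apply: (@continuous_comp _ _ _ (row_cons s)); last exact: cphi.
    exact: continuous_row_cons_tail.
  - by move=> v; have := dphi (row_cons s v); rewrite /derivable quot.
  - rewrite Dpsi => v.
    apply: (@continuous_comp _ _ _ (row_cons s) ('D_(delta_mx 0 (lift ord0 i)) phi)); last exact: cD.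
    exact: continuous_row_cons_tail.
  - move=> v; have := per (row_cons s v); rewrite /psi => <-; congr phi.
    by apply: row_consP => [|k]; rewrite !mxE ?unlift_none ?liftK/= ?mxE
      ?mulr0 ?addr0// (inj_eq lift_inj).
rewrite {j}j0 in dphi cD per *; apply: cubeint_eq0_head => // v.
pose F s := phi (row_cons s v).
have FE : F = (fun k => phi (k *: delta_mx 0 ord0 + row_cons 0 v)).
  by apply/funext => k; rewrite /F -row_cons_shift0 addr0.
have derF s : derivable F s 1 by rewrite FE; exact: derivable_line.
have F' s : derive1 F s = 'D_(delta_mx 0 ord0) phi (row_cons s v).
  by rewrite FE derive_line -row_cons_shift0 addr0.
have cF : continuous F.
  move=> s; apply: (@continuous_comp _ _ _ (fun s => row_cons s v)); last exact: cphi.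
  exact: continuous_row_cons_head.
rewrite (@continuous_FTC2 _ (fun s => 'D_(delta_mx 0 ord0) phi (row_cons s v))
  F 0 (2 * pi) twopi_gt0).
- have -> : F (2 * pi) = F 0.
    rewrite /F -[RHS]per; congr phi.
    by apply: row_consP => [|k]; rewrite !mxE ?unlift_none ?liftK/= ?mulr1
      ?mulr0 ?addr0 ?add0r.
  by rewrite subee.
- apply: continuous_subspaceT => s.
  apply: (@continuous_comp _ _ _ (fun s => row_cons s v) ('D_(delta_mx 0 ord0) phi)); last exact: cD.
  exact: continuous_row_cons_head.
- split => [s _//||].
  + exact/cvg_at_right_filter/cF.
  + exact/cvg_at_left_filter/cF.
- by move=> s _; exact: F'.
Qed.

End cubeint_derive.

Section derive_under_cubeint.
Context {R : realType} {V : normedModType R} (m : nat).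
Context (phi : 'rV[R]_m * V -> R) (w : V).
Hypothesis cphi : continuous phi.
Hypothesis dphi : forall p, derivable phi p (0, w).
Hypothesis cD : continuous (fun p => 'D_(0, w) phi p).

Lemma cvg_derive_cubeint x :
  h^-1 *: (cubeint (fun v => phi (v, h *: w + x)) - cubeint (fun v => phi (v, x)))
    @[h --> 0^'] --> cubeint (fun v => 'D_(0, w) phi (v, x)).
Proof.
pose line (p : R * 'rV[R]_m) : 'rV[R]_m * V := (p.2, p.1 *: w + x).
have cline : continuous line.
  apply: continuous_pair => p; first exact: cvg_snd.
  apply: cvgD; last exact: cvg_cst.
  by apply: cvgZr_tmp; exact: cvg_fst.
pose f (h : R) (t : m.-tuple (measurableTypeR R)) := phi (row_of_tuple t, h *: w + x).
have sect h : continuous (fun v => phi (v, h *: w + x)).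
  move=> v; apply: (@continuous_comp _ _ _ (fun v => (v, h *: w + x))); last exact: cphi.
  by apply: continuous_pair => u; [exact: cvg_id|exact: cst_continuous].
have lineE v h : (v, h *: w + x) = h *: (0, w) + (v, x) :> 'rV[R]_m * V.
  by congr pair => /=; rewrite scaler0 add0r.
have fE t : f ^~ t = (fun h => phi (h *: (0, w) + (row_of_tuple t, x))).
  by apply/funext => h; rewrite /f lineE.
have d1f h t : partial1of2 f h t = 'D_(0, w) phi (row_of_tuple t, h *: w + x).
  by rewrite /partial1of2 fE derive_line -lineE.
(* the dominating function is the maximum of the derivative over the compact
   set of all (v, h) with h in [-1, 1] *)
have [M M0 bM] : exists2 M, 0 <= M & forall h v, -1 <= h <= 1 -> box v ->
    `|'D_(0, w) phi (v, h *: w + x)| <= M.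
  pose K : set (R * 'rV[R]_m) := `[-1, 1]%classic `*` @box R m.
  have cK : compact K by apply: compact_setX; [exact: segment_compact|exact: compact_box].
  have /compact_bounded[M [_ bM]] :
      compact ((fun p => 'D_(0, w) phi (line p)) @` K).
    apply: continuous_compact => //; apply: continuous_subspaceT => p.
    by apply: (@continuous_comp _ _ _ line ('D_(0, w) phi)); [exact: cline|exact: cD].
  exists (`|M| + 1) => [|h v h1 bv]; first by rewrite addr_ge0.
  apply: bM; first by rewrite ltr_pwDr// ler_norm.
  by exists (h, v) => //; split => //=; rewrite in_itv.
have Ia : `]-1, 1[%classic (0 : R) by rewrite /= in_itv/= ltr01 ltrN10.
have H := @cvg_differentiation_under_integral R _ _ (lebesgue_tuple R m) f (@cube R m)
  (@measurable_cube R m) 0 (-1) 1 Ia _ _ (fun=> M).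
have -> : (fun v => 'D_(0, w) phi (v, x)) = (fun v => 'D_(0, w) phi (v, 0 *: w + x)).
  by rewrite scale0r add0r.
have -> : cubeint (fun v => 'D_(0, w) phi (v, 0 *: w + x)) =
    \int[lebesgue_tuple R m]_(t in @cube R m) partial1of2 f 0 t.
  by apply: eq_Rintegral => t _; rewrite d1f.
have -> : (fun h => h^-1 *: (cubeint (fun v => phi (v, h *: w + x)) -
      cubeint (fun v => phi (v, x)))) =
    (fun h => h^-1 *: (\int[lebesgue_tuple R m]_(t in @cube R m) f (h + 0) t -
      \int[lebesgue_tuple R m]_(t in @cube R m) f 0 t)).
  by apply/funext => h; rewrite addr0 /f scale0r add0r.
apply: H => //.
- by move=> h _; exact: (integrable_cube (sect h)).
- move=> h t _ _; rewrite fE; apply: derivable_line; exact: dphi.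
- have cM : continuous (fun _ : 'rV[R]_m => M) by exact: cst_continuous.
  exact: (integrable_cube cM).
- move=> h t; rewrite /= in_itv/= => /andP[h1 h2] /box_row_of_tuple bt; rewrite d1f.
  by apply: bM => //; rewrite !ltW.
Qed.

Lemma derivable_cubeint x :
  derivable (fun y => cubeint (fun v => phi (v, y))) x w.
Proof.
by apply/cvg_ex; exists (cubeint (fun v => 'D_(0, w) phi (v, x)));
  exact: cvg_derive_cubeint.
Qed.

Lemma derive_cubeint x :
  'D_w (fun y => cubeint (fun v => phi (v, y))) x =
  cubeint (fun v => 'D_(0, w) phi (v, x)).
Proof. by apply/cvg_lim => //; exact: cvg_derive_cubeint. Qed.

End derive_under_cubeint.

(** * Trigonometric preliminaries *)

Section trigonometry.
Context {R : realType}.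

Lemma cosD2pi_int (u : R) (z : int) : cos (u + z%:~R * (2 * pi)) = cos u.
Proof.
have cosDn (v : R) n : cos (v + n%:R * (2 * pi)) = cos v.
  have -> : n%:R * (2 * pi) = (pi *+ 2) *+ n :> R.
    by rewrite -(mulr_natl (pi *+ 2)) -(mulr_natl pi).
  by rewrite periodicn//; exact: cosD2pi.
case: z => n; first exact: cosDn.
rewrite NegzE mulrNz mulNr -(cosDn (u - n.+1%:~R * (2 * pi)) n.+1).
by rewrite subrK.
Qed.

Lemma cos_eq1 (u : R) : cos u = 1 -> exists z : int, u = z%:~R * (2 * pi).
Proof.
move=> cu; set z := Num.floor (u / (2 * pi)); exists z.
set r := u - z%:~R * (2 * pi).
have p0 : 0 < pi :> R := pi_gt0 R.
have tp := @twopi_gt0 R.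
have r0 : 0 <= r.
  by rewrite subr_ge0 -ler_pdivlMr// Num.Theory.floor_le.
have r2 : r < 2 * pi.
  have := floorD1_gt (u / (2 * pi)).
  rewrite -/z ltr_pdivrMr// intrD mulrDl mul1r => h.
  by rewrite ltrBlDl.
have cr : cos r = 1.
  by rewrite -(cosD2pi_int r z) subrK.
have cos1 x : 0 <= x <= pi -> cos x = 1 -> x = 0 :> R.
  move=> xp cx; apply: cos_inj; rewrite ?in_itv//= ?lexx ?pi_ge0//.
  by rewrite cos0.
suff : r = 0 by move/eqP; rewrite subr_eq0 => /eqP.
have [rp|rp] := leP r pi; first by apply: cos1 => //; rewrite r0.
suff : 2 * pi - r = 0 by lra.
apply: cos1; first by apply/andP; split; lra.
rewrite -(cosD2pi_int _ (-1)) -[RHS]cr -[RHS]cosN.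
by congr cos; rewrite mulrN1z; ring.
Qed.

End trigonometry.

Section derive_comp_linear.
Context {R : realType} {V : normedModType R}.

(** Chain rule along a direction in which [L] varies affinely, with slope [a]. *)
Lemma is_derive_comp_affine (L : V -> R) (F : R -> R) (v w : V) (a dF : R) :
  (forall h, L (h *: w + v) = h * a + L v) -> is_derive (L v) 1 F dF ->
  is_derive v w (F \o L) (a * dF).
Proof.
move=> Lh FdF.
have lineE : (fun k : R => (F \o L) (k *: w + v)) = F \o (fun k => k * a + L v).
  by apply/funext => k /=; rewrite Lh.
have dline : is_derive (0 : R) 1 (F \o (fun k => k * a + L v)) (dF * a).
  apply: is_derive1_comp; first by rewrite mul0r add0r.
  have -> : (fun k : R => k * a + L v) = a *: id + cst (L v).
    by apply/funext => k; rewrite /= mulrC.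
  by apply: is_derive_eq; rewrite addr0 [_ *: _]mulr1.
split.
  by apply/derivable1P; rewrite lineE.
rewrite -[v]add0r -[0](scale0r w) -derive_line lineE derive1E.
by rewrite derive_val mulrC.
Qed.

End derive_comp_linear.

Section continuous_operations.
Context {R : realType} {T : topologicalType}.
Implicit Types f g : T -> R.

Lemma continuous_const (c : R) : continuous (fun _ : T => c).
Proof. exact: cst_continuous. Qed.

Lemma continuous_add f g : continuous f -> continuous g -> continuous (fun x => f x + g x).
Proof. by move=> cf cg x; apply: cvgD; [exact: cf|exact: cg]. Qed.

Lemma continuous_opp f : continuous f -> continuous (fun x => - f x).
Proof. by move=> cf x; apply: cvgN; exact: cf. Qed.

Lemma continuous_sub f g : continuous f -> continuous g -> continuous (fun x => f x - g x).
Proof. by move=> cf cg; apply: continuous_add => //; exact: continuous_opp. Qed.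

Lemma continuous_mul f g : continuous f -> continuous g -> continuous (fun x => f x * g x).
Proof. by move=> cf cg x; apply: cvgM; [exact: cf|exact: cg]. Qed.

Lemma continuous_compR (F : R -> R) f : continuous F -> continuous f ->
  continuous (fun x => F (f x)).
Proof.
move=> cF cf x.
by apply: (@continuous_comp _ _ _ f F); [exact: cf|exact: cF].
Qed.

End continuous_operations.

(** * Characters of the torus *)

Section dot_product.
Context {R : realType} {m : nat}.
Implicit Types (k u v : 'rV[R]_m).

Lemma dotpDr k u v : dotp k (u + v) = dotp k u + dotp k v.
Proof.
by rewrite /dotp -big_split; apply: eq_bigr => j _; rewrite mxE mulrDr.
Qed.

Lemma dotpZr k u (h : R) : dotp k (h *: u) = h * dotp k u.
Proof.
by rewrite /dotp mulr_sumr; apply: eq_bigr => j _; rewrite mxE mulrCA.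
Qed.

Lemma dotp_delta k j : dotp k (delta_mx 0 j) = k 0 j.
Proof.
rewrite /dotp (bigD1 j)//= mxE !eqxx mulr1 big1 ?addr0// => i /negPf ij.
by rewrite mxE ij andbF mulr0.
Qed.

Lemma dotpBl k l u : dotp (k - l) u = dotp k u - dotp l u.
Proof.
rewrite /dotp -sumrB; apply: eq_bigr => j _.
by rewrite !mxE mulrBl.
Qed.

Lemma continuous_dotp k : continuous (dotp k).
Proof.
apply: continuous_sumr => j.
by apply: continuous_mul; [exact: continuous_const|exact: coord_continuous].
Qed.

Lemma continuous_trig_dotp (F : R -> R) k u : continuous F ->
  continuous (fun v => F (dotp k (v - u))).
Proof.
move=> cF; apply: continuous_compR => // v.
have -> : (fun v => dotp k (v - u)) = (fun v => dotp k v + dotp k (- u)).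
  by apply/funext => w; rewrite dotpDr.
by apply: continuous_add; [exact: continuous_dotp|exact: continuous_const].
Qed.

End dot_product.

Section orthogonality.
Context {R : realType} {m : nat} (u : 'rV[R]_m).

(** The cosine is, up to the nonzero factor l_j, the j-th derivative of the
    periodic function sin(l.(v - u)). *)
Lemma cubeint_cos_dotp (l : 'rV[int]_m) : l != 0 ->
  cubeint (fun v => cos (dotp (int_vec R l) (v - u))) = 0.
Proof.
move=> /rV0Pn[j lj0].
set L := fun v => dotp (int_vec R l) (v - u).
pose phi := sin \o L.
have Dphi v : is_derive v (delta_mx 0 j) phi ((l 0 j)%:~R * cos (L v)).
  apply: (@is_derive_comp_affine _ _ L) => h.
  by rewrite /L -addrA dotpDr dotpZr dotp_delta mxE.
have DphiE : (fun v => 'D_(delta_mx 0 j) phi v) =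
    (fun v => (l 0 j)%:~R * cos (L v)).
  by apply/funext => v; rewrite derive_val.
have cphi : continuous phi by apply: continuous_trig_dotp; exact: continuous_sin.
have ccos : continuous (fun v => cos (L v)).
  by apply: continuous_trig_dotp; exact: continuous_cos.
suff : cubeint (fun v => 'D_(delta_mx 0 j) phi v) = 0.
  rewrite DphiE cubeintZ// => /eqP; rewrite mulf_eq0 intr_eq0 (negPf lj0).
  by move=> /eqP.
apply: cubeint_derive_eq0 => //.
- by rewrite DphiE; apply: continuous_mul => //; exact: continuous_const.
- move=> v; rewrite /phi/= /L addrAC dotpDr dotpZr dotp_delta mxE.
  rewrite -!cosBpihalf addrAC [2 * pi * _]mulrC.
  exact: cosD2pi_int.
Qed.

End orthogonality.

(** * Pointwise bounds from Fourier coefficients *)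

Section korovkin.
Context {R : realType} {m : nat}.
Implicit Types (G : 'rV[R]_m -> R) (u v : 'rV[R]_m).

(** Nonnegativity of the Fejer kernel: it is a squared modulus. *)
Lemma sum_cosB (P : finType) (theta : P -> R) :
  \sum_p \sum_q cos (theta p - theta q) =
  (\sum_p cos (theta p)) ^+ 2 + (\sum_p sin (theta p)) ^+ 2.
Proof.
rewrite !expr2 !mulr_suml -big_split; apply: eq_bigr => p _ /=.
by rewrite !mulr_sumr -big_split; apply: eq_bigr => q _; rewrite cosB.
Qed.

Lemma sum_cosBD (P : finType) (theta : P -> R) (s : R) :
  \sum_p \sum_q cos (theta p - theta q + s) =
  (\sum_p \sum_q cos (theta p - theta q)) * cos s.
Proof.
pose Sn := \sum_p \sum_q sin (theta p - theta q).
have Sn0 : Sn = 0.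
  suff : Sn = - Sn by lra.
  rewrite {1}/Sn exchange_big/= -sumrN; apply: eq_bigr => p _.
  by rewrite -sumrN; apply: eq_bigr => q _; rewrite -sinN opprB.
transitivity ((\sum_p \sum_q cos (theta p - theta q)) * cos s - Sn * sin s);
  last by rewrite Sn0 mul0r subr0.
rewrite /Sn !mulr_suml -sumrB; apply: eq_bigr => p _.
rewrite !mulr_suml -sumrB; apply: eq_bigr => q _.
by rewrite cosD.
Qed.

(** Periodicity of period 2pi in each variable. *)
Definition torus_periodic G :=
  forall j v, G (v + (2 * pi) *: delta_mx 0 j) = G v.

Lemma torus_periodic_int G (z : 'I_m -> int) u : torus_periodic G ->
  G (u + \row_j ((z j)%:~R * (2 * pi))) = G u.
Proof.
move=> perG.
have perGn n j v : G (v + n%:R *: ((2 * pi) *: delta_mx 0 j)) = G v.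
  elim: n v => [|n IH] v; first by rewrite scale0r addr0.
  by rewrite -natr1 scalerDl scale1r addrA perG IH.
have perGz (a : int) j v : G (v + a%:~R *: ((2 * pi) *: delta_mx 0 j)) = G v.
  case: a => n; first exact: perGn.
  rewrite NegzE mulrNz scaleNr -[LHS](perGn n.+1 j).
  by rewrite subrK.
rewrite [X in u + X]row_sum_delta.
suff H (r : seq 'I_m) v :
    G (v + \sum_(j <- r) ((z j)%:~R *: ((2 * pi) *: delta_mx 0 j))) = G v.
  rewrite -[RHS](H (index_enum _)); congr (G (_ + _)); apply: eq_bigr => j _.
  by rewrite mxE scalerA.
elim: r v => [|j r IH] v; first by rewrite big_nil addr0.
by rewrite big_cons addrA IH perGz.
Qed.

(** Where G u - G v >= eta, the sum of the 1 - cos is bounded below by a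
    positive constant: this set is compact, and at a zero of the sum the point
    v differs from u by periods, so that G v = G u. *)
Lemma korovkin_modulus G u (eta : R) : continuous G -> torus_periodic G ->
  0 < eta -> exists2 C, 0 <= C & forall v, box v ->
    G u - G v <= eta + C * \sum_j (1 - cos (v 0 j - u 0 j)).
Proof.
move=> cG perG eta0.
pose E v := \sum_j (1 - cos (v 0 j - u 0 j)).
have E0 v : 0 <= E v by apply: sumr_ge0 => j _; rewrite subr_ge0 cos_le1.
have cE : continuous E.
  apply: continuous_sumr => j; apply: continuous_sub; first exact: continuous_const.
  apply: continuous_compR; first exact: continuous_cos.
  by apply: continuous_sub; [exact: coord_continuous|exact: continuous_const].
have cGu : continuous (fun v => G u - G v).
  by apply: continuous_sub => //; exact: continuous_const.
pose K := box (m := m) `&` [set v | eta <= G u - G v].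
have cK : compact K.
  apply: compact_closedI; first exact: compact_box.
  apply: (@preimage_closed _ _ (fun v => G u - G v) [set x | eta <= x]).
    by move=> v _; exact: cGu.
  exact: closed_ge.
have [K0|/nonemptyPn K0] := pselect (K !=set0); last first.
  exists 0 => // v bv; rewrite mul0r addr0 leNgt; apply/negP => /ltW h.
  by have : K v by []; rewrite K0.
have [c cinK cmin] : exists2 c, c \in K & forall v, v \in K -> E c <= E v.
  by apply: compact_EVT_min => //; exact: continuous_subspaceT.
have Ec : 0 < E c.
  rewrite lt_neqAle E0 andbT; apply/eqP => /esym /eqP.
  rewrite psumr_eq0; last by move=> j _; rewrite subr_ge0 cos_le1.
  move=> /allP cj.
  have H j : exists z : int, c 0 j - u 0 j = z%:~R * (2 * pi).
    apply: cos_eq1; have /= := cj j (mem_index_enum _).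
    by rewrite subr_eq0 => /eqP.
  have [z zE] := choice H.
  have ceq : G c = G u.
    rewrite -(torus_periodic_int z u perG); congr G.
    by apply/rowP => j; rewrite !mxE -zE addrC subrK.
  by move: cinK; rewrite inE => -[_ /=]; rewrite ceq subrr leNgt eta0.
have [M M0 bM] := bounded_box cGu.
have MC0 : 0 <= M / E c by rewrite divr_ge0// ltW.
exists (M / E c) => // v bv.
have [h|/ltW h] := leP eta (G u - G v); last first.
  by apply: (le_trans h); rewrite lerDl; exact: (mulr_ge0 MC0 (E0 v)).
apply: (@le_trans _ _ M).
  by apply: le_trans (ler_norm _) _; exact: bM.
apply: (@le_trans _ _ (M / E c * E v)); last by rewrite lerDr ltW.
rewrite -mulrA ler_peMr// mulrC ler_pdivlMr// mul1r.
by apply: cmin; rewrite inE.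
Qed.

End korovkin.

Section fejer_kernel.
Context {R : realType} {m : nat} (u : 'rV[R]_m) (N' : nat).
Let N := N'.+1.
Let P := {ffun 'I_m -> 'I_N}.
Let T : R := (2 * pi) ^+ m.

Let ivec (p : P) : 'rV[int]_m := \row_j (p j)%:Z.
Let theta (p : P) (v : 'rV[R]_m) : R := dotp (int_vec R (ivec p)) (v - u).

(** The product Fejer kernel centred at [u], not normalized: the squared
    modulus of the sum of the exponentials exp(i p.(v - u)) over the p in
    {0, ..., N - 1}^m.  Its integral is (2pi)^m N^m. *)
Definition fejer (v : 'rV[R]_m) : R :=
  \sum_(p : P) \sum_(q : P) cos (dotp (int_vec R (ivec p - ivec q)) (v - u)).

Let int_vecB (k l : 'rV[int]_m) : int_vec R (k - l) = int_vec R k - int_vec R l.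
Proof. by apply/rowP => j; rewrite !mxE intrB. Qed.

Let fejerE v : fejer v = \sum_p \sum_q cos (theta p v - theta q v).
Proof.
apply: eq_bigr => p _; apply: eq_bigr => q _.
by rewrite int_vecB dotpBl.
Qed.

Lemma fejer_ge0 v : 0 <= fejer v.
Proof. by rewrite fejerE sum_cosB addr_ge0// sqr_ge0. Qed.

Let ccos (l : 'rV[int]_m) : continuous (fun v : 'rV[R]_m => cos (dotp (int_vec R l) (v - u))).
Proof. by apply: continuous_trig_dotp; exact: continuous_cos. Qed.

Lemma continuous_fejer : continuous fejer.
Proof. by apply: continuous_sumr => p; apply: continuous_sumr => q; exact: ccos. Qed.

Let ivec_inj : injective ivec.
Proof.
move=> p q /rowP pq; apply/ffunP => j; apply: val_inj.
by have := pq j; rewrite !mxE => -[].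
Qed.

Let cubeint_cos (l : 'rV[int]_m) :
  cubeint (fun v => cos (dotp (int_vec R l) (v - u))) = T * (l == 0)%:R.
Proof.
have [->|l0] := eqVneq; last by rewrite cubeint_cos_dotp// mulr0.
rewrite mulr1 -[RHS]mul1r -cubeint_cst; congr cubeint; apply/funext => v.
by rewrite /dotp big1 ?cos0// => j _; rewrite !mxE mul0r.
Qed.

Let card_P : (#|P|%:R : R) = N%:R ^+ m.
Proof. by rewrite card_ffun !card_ord natrX. Qed.

Lemma cubeint_fejer : cubeint fejer = T * N%:R ^+ m.
Proof.
rewrite cubeint_sum; last by move=> p; apply: continuous_sumr => q; exact: ccos.
rewrite -card_P mulr_natr -sumr_const; apply: eq_bigr => p _.
rewrite cubeint_sum; last by move=> q; exact: ccos.
rewrite (bigD1 p)//= cubeint_cos subrr eqxx mulr1 big1 ?addr0// => q /negPf qp.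
by rewrite cubeint_cos subr_eq0 (inj_eq ivec_inj) eq_sym qp mulr0.
Qed.

Let fejer_cos j v : fejer v * cos (v 0 j - u 0 j) =
  \sum_p \sum_q cos (dotp (int_vec R (ivec p - ivec q + delta_mx 0 j)) (v - u)).
Proof.
rewrite fejerE -sum_cosBD; apply: eq_bigr => p _; apply: eq_bigr => q _.
congr cos; rewrite -[delta_mx 0 j]opprK int_vecB dotpBl int_vecB dotpBl.
congr (_ + _); rewrite /dotp -sumrN (bigD1 j)//= big1 ?addr0 => [|i /negPf ij].
  by rewrite !mxE !eqxx mulrNz mulN1r opprK.
by rewrite !mxE ij andbF oppr0 mul0r oppr0.
Qed.

(* the number of p with p_j + 1 < N is (N - 1) N^(m - 1) *)
Let card_succ j :
  N%:R * (\sum_(p : P) ((p j).+1 < N)%N%:R) = (N%:R - 1) * N%:R ^+ m :> R.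
Proof.
pose F (i : 'I_m) (k : 'I_N) : R := if i == j then (k.+1 < N)%N%:R else 1.
have -> : \sum_(p : P) ((p j).+1 < N)%N%:R = \prod_i \sum_k F i k.
  rewrite bigA_distr_bigA; apply: eq_bigr => p _.
  rewrite (bigD1 j)//= big1 ?mulr1 /F ?eqxx// => i /negPf ij.
  by rewrite ij.
have Fj : \sum_k F j k = N%:R - 1.
  rewrite /F eqxx big_ord_recr/= ltnn addr0.
  rewrite (eq_bigr (fun=> 1)) => [|k _]; last by rewrite /= ltnS ltn_ord.
  by rewrite sumr_const card_ord -[N%:R]natr1 addrK.
have FN i : i != j -> \sum_k F i k = N%:R.
  move=> /negPf ij; rewrite /F ij sumr_const card_ord//.
rewrite (bigD1 j)//= Fj (eq_bigr _ FN) mulrCA; congr (_ * _).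
have <- : \prod_(i < m) (N%:R : R) = N%:R ^+ m by rewrite prodr_const card_ord.
by rewrite [RHS](bigD1 j).
Qed.

(** The first harmonics of the kernel carry a fraction at least 1 - 1/N of
    its mass. *)
Lemma cubeint_fejer_cos j :
  T * ((N%:R - 1) * N%:R ^+ m) <=
  N%:R * cubeint (fun v => fejer v * cos (v 0 j - u 0 j)).
Proof.
under [X in cubeint X]eq_fun do rewrite fejer_cos.
rewrite cubeint_sum; last by move=> p; apply: continuous_sumr => q; exact: ccos.
rewrite -(card_succ j) mulrCA ler_pM2l ?ltr0n// mulr_sumr; apply: ler_sum => p _.
rewrite cubeint_sum; last by move=> q; exact: ccos.
have T0 : 0 <= T by rewrite exprn_ge0// ltW// twopi_gt0.
have pos q : 0 <= cubeint (fun v =>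
    cos (dotp (int_vec R (ivec p - ivec q + delta_mx 0 j)) (v - u))).
  by rewrite cubeint_cos mulr_ge0.
case: ltnP => pj; last by rewrite mulr0 sumr_ge0.
(* the summand with frequency 0 is the one where q = p + e_j *)
pose q : P := [ffun i => if i == j then Ordinal pj else p i].
rewrite (bigD1 q)//= cubeint_cos mulr1 (_ : _ == 0) ?mulr1.
  by rewrite lerDl sumr_ge0.
apply/eqP/rowP => i; rewrite !mxE ffunE eqxx/=.
case: eqP => [->|_]; last by rewrite subrr addr0.
by rewrite /= intS; ring.
Qed.

End fejer_kernel.

Section sup_bound.
Context {R : realType} {m : nat} (G : 'rV[R]_m -> R) (u : 'rV[R]_m).
Context (w : int -> R) (A W : R).
Hypotheses (cG : continuous G) (perG : torus_periodic G).
Hypotheses (A0 : 0 <= A) (w0 : forall k, 0 <= w k).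
Hypothesis wW : forall N (p : 'I_N), \sum_(q < N) w (p%:Z - q%:Z) <= W.
Hypothesis GA : forall l : 'rV[int]_m,
  `|cubeint (fun v => G v * cos (dotp (int_vec R l) (v - u)))| <=
  (2 * pi) ^+ m * (A * \prod_j w (l 0 j)).

Let T : R := (2 * pi) ^+ m.

Let cubeint_mul_fejer N' :
  cubeint (fun v => G v * fejer u N' v) <= T * N'.+1%:R ^+ m * (A * W ^+ m).
Proof.
set N := N'.+1; pose P := {ffun 'I_m -> 'I_N}.
have cGcos (l : 'rV[int]_m) :
    continuous (fun v => G v * cos (dotp (int_vec R l) (v - u))).
  apply: continuous_mul => //; apply: continuous_trig_dotp.
  exact: continuous_cos.
under [X in cubeint X]eq_fun do rewrite /fejer mulr_sumr.
rewrite cubeint_sum => [|p]; last first.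
  under eq_fun do rewrite mulr_sumr.
  by apply: continuous_sumr => q; exact: cGcos.
have -> : T * N%:R ^+ m * (A * W ^+ m) = \sum_(p : P) T * (A * W ^+ m).
  by rewrite sumr_const -[RHS]mulr_natl card_ffun !card_ord natrX; ring.
apply: ler_sum => p _.
under [X in cubeint X]eq_fun do rewrite mulr_sumr.
rewrite cubeint_sum => [|q]; last exact: cGcos.
apply: (@le_trans _ _ (\sum_(q : P) T * (A * \prod_j w ((p j)%:Z - (q j)%:Z)))).
  apply: ler_sum => q _; apply: le_trans (ler_norm _) _.
  apply: le_trans (GA _) _; rewrite le_eqVlt; apply/orP; left; apply/eqP.
  by congr (_ * (_ * _)); apply: eq_bigr => j _; rewrite !mxE.
have T0 : 0 <= T by rewrite exprn_ge0// ltW// twopi_gt0.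
rewrite -mulr_sumr ler_wpM2l// -mulr_sumr ler_wpM2l//.
rewrite -(bigA_distr_bigA (fun j (k : 'I_N) => w ((p j)%:Z - k%:Z))).
have -> : W ^+ m = \prod_(j < m) W by rewrite prodr_const card_ord.
apply: ler_prod => j _; apply/andP; split; last exact: wW.
by apply: sumr_ge0 => k _; exact: w0.
Qed.

(** A continuous periodic function whose Fourier coefficients are bounded by
    A times a product of weights of sums at most W is bounded by A W^m.  The
    hypothesis is on the real form of the coefficients, with phase at [u]. *)
Lemma ler_of_fourier : G u <= A * W ^+ m.
Proof.
apply/ler_addgt0Pr => e e0.
have e2 : 0 < e / 2 by rewrite divr_gt0.
have [C C0 GC] := korovkin_modulus u cG perG e2.
(* N is chosen so that the Korovkin error C m / N is at most e / 2 *)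
pose N' := Num.truncn (C * m%:R / (e / 2)); set N := N'.+1.
have N0 : 0 < N%:R :> R by rewrite ltr0n.
have T0 : 0 < T by rewrite exprn_gt0// twopi_gt0.
have CN : C * m%:R / N%:R <= e / 2.
  rewrite ler_pdivrMr// -ler_pdivrMl// mulrC ltW//.
  by rewrite /N /N' truncnS_gt.
set K := fejer u N'.
have cK : continuous K by exact: continuous_fejer.
have cKcos j : continuous (fun v => K v * cos (v 0 j - u 0 j)).
  apply: continuous_mul => //; apply: continuous_compR; first exact: continuous_cos.
  by apply: continuous_sub; [exact: coord_continuous|exact: continuous_const].
have cD j : continuous (fun v => K v - K v * cos (v 0 j - u 0 j)).
  exact: continuous_sub.
pose D v := \sum_j (K v - K v * cos (v 0 j - u 0 j)).
have cDD : continuous D by exact: continuous_sumr.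
have main : cubeint (fun v => G u * K v) <=
    cubeint (fun v => G v * K v + (e / 2 * K v + C * D v)).
  apply: ler_cubeint.
  - by apply: continuous_mul => //; exact: continuous_const.
  - apply: continuous_add; first exact: continuous_mul.
    by apply: continuous_add; apply: continuous_mul => //; exact: continuous_const.
  - move=> v bv; have DE : D v = K v * \sum_j (1 - cos (v 0 j - u 0 j)).
      by rewrite mulr_sumr; apply: eq_bigr => j _; rewrite mulrBr mulr1.
    rewrite -lerBlDl -mulrBl DE mulrCA mulrC [e / 2 * _]mulrC -mulrDr.
    by apply: ler_wpM2l; [exact: fejer_ge0|exact: GC].
have cD1 : continuous (fun v => e / 2 * K v).
  by apply: continuous_mul => //; exact: continuous_const.
have cD2 : continuous (fun v => C * D v).
  by apply: continuous_mul => //; exact: continuous_const.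
move: main; rewrite cubeintZ// cubeintD; [|exact: continuous_mul|exact: continuous_add].
rewrite cubeintD// cubeintZ// cubeintZ// cubeint_fejer -/T -/N => main.
have ND : N%:R * cubeint D <= m%:R * (T * N%:R ^+ m).
  have -> : m%:R * (T * N%:R ^+ m) = \sum_(j < m) T * N%:R ^+ m.
    by rewrite sumr_const card_ord mulr_natl.
  rewrite cubeint_sum// mulr_sumr.
  apply: ler_sum => j _.
  have -> : cubeint (fun v => K v - K v * cos (v 0 j - u 0 j)) =
      T * N%:R ^+ m - cubeint (fun v => K v * cos (v 0 j - u 0 j)).
    rewrite -(cubeint_fejer u N') -[X in _ = _ + X]mulN1r -cubeintZ// -cubeintD//.
      by congr cubeint; apply/funext => v; rewrite mulN1r.
    by apply: continuous_mul => //; exact: continuous_const.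
  have := @cubeint_fejer_cos R m u N' j; rewrite -/T -/N -/K; nra.
have S0 : 0 < T * N%:R ^+ m by rewrite mulr_gt0// exprn_gt0.
rewrite -(ler_pM2r S0); apply: le_trans main _.
have h1 := @cubeint_mul_fejer N'; rewrite -/K -/N in h1.
have h2 : C * cubeint D <= e / 2 * (T * N%:R ^+ m).
  apply: (@le_trans _ _ (C * (m%:R * (T * N%:R ^+ m) / N%:R))).
    by rewrite ler_wpM2l// ler_pdivlMr// mulrC.
  have -> : C * (m%:R * (T * N%:R ^+ m) / N%:R) =
     (C * m%:R / N%:R) * (T * N%:R ^+ m) by ring.
  by rewrite ler_pM2r.
lra.
Qed.

End sup_bound.

(** * Complex-valued functions *)

Section complex_calculus.
Context {R : realType}.
Implicit Types z : R[i].

Lemma ReM z1 z2 : complex.Re (z1 * z2) =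
  complex.Re z1 * complex.Re z2 - complex.Im z1 * complex.Im z2.
Proof. by case: z1 => a b; case: z2 => c d. Qed.

Lemma ImM z1 z2 : complex.Im (z1 * z2) =
  complex.Re z1 * complex.Im z2 + complex.Im z1 * complex.Re z2.
Proof. by case: z1 => a b; case: z2 => c d. Qed.

Lemma eq_ReIm z1 z2 : complex.Re z1 = complex.Re z2 ->
  complex.Im z1 = complex.Im z2 -> z1 = z2.
Proof. by case: z1 => a b; case: z2 => c d /= -> ->. Qed.

Lemma ler_Re_normc z : `|complex.Re z| <= Normc.normc z.
Proof.
case: z => a b /=; rewrite -sqrtr_sqr ler_sqrt ?addr_ge0 ?sqr_ge0//.
by rewrite lerDl sqr_ge0.
Qed.

Lemma ler_Im_normc z : `|complex.Im z| <= Normc.normc z.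
Proof.
case: z => a b /=; rewrite -sqrtr_sqr ler_sqrt ?addr_ge0 ?sqr_ge0//.
by rewrite lerDr sqr_ge0.
Qed.

Lemma ler_normc_ReIm z : Normc.normc z <= `|complex.Re z| + `|complex.Im z|.
Proof.
case: z => a b /=; rewrite -[leRHS]ger0_norm ?addr_ge0// -sqrtr_sqr.
rewrite ler_sqrt ?sqr_ge0// sqrrD !real_normK ?num_real//.
by rewrite lerD2r lerDl mulrn_wge0// mulr_ge0.
Qed.

Lemma normc_ge0 z : 0 <= Normc.normc z.
Proof. by case: z => a b; exact: sqrtr_ge0. Qed.

Lemma normcR (a : R) : Normc.normc a%:C = `|a|.
Proof. by rewrite /= expr0n/= addr0 sqrtr_sqr. Qed.

Lemma normc_imag (a : R) : Normc.normc (0 +i* a) = `|a|.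
Proof. by rewrite /= expr0n/= add0r sqrtr_sqr. Qed.

Lemma normc_cexpi (a : R) : Normc.normc (cexpi a) = 1.
Proof. by rewrite /= cos2Dsin2 sqrtr1. Qed.

Lemma normc_prod (I : Type) (r : seq I) (F : I -> R[i]) :
  Normc.normc (\prod_(i <- r) F i) = \prod_(i <- r) Normc.normc (F i).
Proof.
elim/big_rec2: _ => [|i a b _ <-]; first exact: Normc.normc1.
exact: Normc.normcM.
Qed.

Lemma normcX z n : Normc.normc (z ^+ n) = Normc.normc z ^+ n.
Proof.
elim: n => [|n IH]; first by rewrite !expr0 Normc.normc1.
by rewrite !exprS Normc.normcM IH.
Qed.

Context {V : normedModType R}.
Implicit Types (g h : V -> R[i]) (w p : V).

Lemma ccontinuousM g h : ccontinuous g -> ccontinuous h ->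
  ccontinuous (fun q => g q * h q).
Proof.
move=> [cg1 cg2] [ch1 ch2]; split.
  under eq_fun do rewrite ReM.
  by apply: continuous_sub; exact: continuous_mul.
under eq_fun do rewrite ImM.
by apply: continuous_add; exact: continuous_mul.
Qed.

Lemma ccontinuousD g h : ccontinuous g -> ccontinuous h ->
  ccontinuous (fun q => g q + h q).
Proof.
move=> [cg1 cg2] [ch1 ch2]; split.
  have -> : (fun q => complex.Re (g q + h q)) =
      (fun q => complex.Re (g q) + complex.Re (h q)).
    by apply/funext => q; case: (g q) => a b; case: (h q).
  exact: continuous_add.
have -> : (fun q => complex.Im (g q + h q)) =
    (fun q => complex.Im (g q) + complex.Im (h q)).
  by apply/funext => q; case: (g q) => a b; case: (h q).
exact: continuous_add.
Qed.

Lemma ccontinuous_cst z : ccontinuous (fun _ : V => z).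
Proof. by split; exact: continuous_const. Qed.

(** [g] has derivative [g'] in the direction [w], at every point. *)
Definition is_cderive w g g' : Prop := forall p,
  is_derive p w (fun q => complex.Re (g q)) (complex.Re (g' p)) /\
  is_derive p w (fun q => complex.Im (g q)) (complex.Im (g' p)).

Lemma is_cderiveP w g g' :
  is_cderive w g g' <-> cderivable g w /\ cderive w g = g'.
Proof.
split=> [dg|[dg <-] p].
  split=> [p|]; first by have [[? _] [? _]] := dg p.
  apply/funext => p; have [[_ h1] [_ h2]] := dg p.
  by apply: eq_ReIm; rewrite /cderive/=.
by have [h1 h2] := dg p; split; exact: derivableP.
Qed.

Lemma is_cderiveM w g h g' h' : is_cderive w g g' -> is_cderive w h h' ->
  is_cderive w (fun q => g q * h q) (fun q => g' q * h q + g q * h' q).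
Proof.
move=> dg dh p; have [dg1 dg2] := dg p; have [dh1 dh2] := dh p; split.
  have -> : (fun q => complex.Re (g q * h q)) =
      (fun q => complex.Re (g q)) * (fun q => complex.Re (h q)) -
      (fun q => complex.Im (g q)) * (fun q => complex.Im (h q)).
    by apply/funext => q; rewrite ReM.
  apply: (is_derive_eq (is_deriveB (is_deriveM dg1 dh1) (is_deriveM dg2 dh2))).
  rewrite -![_ *: _]/(_ * _).
  case: (g p) (g' p) (h p) (h' p) => [a b] [a' b'] [c d] [c' d'] /=; ring.
have -> : (fun q => complex.Im (g q * h q)) =
    (fun q => complex.Re (g q)) * (fun q => complex.Im (h q)) +
    (fun q => complex.Im (g q)) * (fun q => complex.Re (h q)).
  by apply/funext => q; rewrite ImM.
apply: (is_derive_eq (is_deriveD (is_deriveM dg1 dh2) (is_deriveM dg2 dh1))).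
rewrite -![_ *: _]/(_ * _).
case: (g p) (g' p) (h p) (h' p) => [a b] [a' b'] [c d] [c' d'] /=; ring.
Qed.

Lemma is_cderive_cst w z : is_cderive w (fun=> z) (fun=> 0).
Proof. by move=> p; split; exact: is_derive_cst. Qed.

Lemma is_cderiveZ w z g g' : is_cderive w g g' ->
  is_cderive w (fun q => z * g q) (fun q => z * g' q).
Proof.
move=> dg; have := is_cderiveM (is_cderive_cst w z) dg.
by under [X in is_cderive _ _ X -> _]eq_fun do rewrite mul0r add0r.
Qed.

End complex_calculus.

Section complex_integral.
Context {R : realType} {m : nat}.
Implicit Types G : 'rV[R]_m -> R[i].

(** Integral over the period cube of a complex-valued function. *)
Definition cubeintC G : R[i] :=
  cubeint (fun v => complex.Re (G v)) +i* cubeint (fun v => complex.Im (G v)).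

Lemma cubeintCZ z G : ccontinuous G ->
  cubeintC (fun v => z * G v) = z * cubeintC G.
Proof.
case: z => a b [cG1 cG2]; rewrite /cubeintC.
have cZ (c : R) (F : 'rV[R]_m -> R) : continuous F -> continuous (fun v => c * F v).
  by move=> cF; apply: continuous_mul => //; exact: continuous_const.
apply: eq_ReIm => /=.
  under [X in cubeint X]eq_fun do rewrite ReM /= -mulNr.
  by rewrite cubeintD ?cubeintZ ?mulNr//; exact: cZ.
under [X in cubeint X]eq_fun do rewrite ImM /=.
by rewrite cubeintD ?cubeintZ//; exact: cZ.
Qed.

Lemma cubeintCD G H : ccontinuous G -> ccontinuous H ->
  cubeintC (fun v => G v + H v) = cubeintC G + cubeintC H.
Proof.
move=> [cG1 cG2] [cH1 cH2]; apply: eq_ReIm => /=; rewrite -cubeintD//.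
  by congr cubeint; apply/funext => v; case: (G v) => a b; case: (H v).
by congr cubeint; apply/funext => v; case: (G v) => a b; case: (H v).
Qed.

Lemma ler_normc_cubeintC G (M : R) : ccontinuous G ->
  (forall v, box v -> Normc.normc (G v) <= M) ->
  Normc.normc (cubeintC G) <= 2 * M * (2 * pi) ^+ m.
Proof.
move=> [cG1 cG2] GM; apply: le_trans (ler_normc_ReIm _) _ => /=.
rewrite -mulrA mulr_natl mulr2n; apply: lerD; apply: ler_norm_cubeint => //.
- by move=> v /GM; apply: le_trans; exact: ler_Re_normc.
- by move=> v /GM; apply: le_trans; exact: ler_Im_normc.
Qed.

End complex_integral.

(** * Fourier coefficients of derivatives *)

Section fourier_derivatives.
Context {R : realType} {m n : nat}.
Local Notation dom := ('rV[R]_m * 'rV[R]_n)%type.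
Implicit Types (f h : dom -> R[i]) (k : 'rV[int]_m).

(** The character exp(-i k.t), seen as a function of (t, x) so that product
    rules apply in both groups of variables. *)
Definition character k (p : dom) : R[i] := cexpi (- dotp (int_vec R k) p.1).

Lemma fourier_coefE f k x : fourier_coef f k x =
  ((2 * pi) ^- m)%:C * cubeintC (fun v => f (v, x) * character k (v, x)).
Proof. by []. Qed.

Lemma ccontinuous_character k : ccontinuous (character k).
Proof.
have cL : continuous (fun p : dom => - dotp (int_vec R k) p.1).
  apply: continuous_opp => p.
  apply: (@continuous_comp _ _ _ fst (dotp (int_vec R k))); first exact: cvg_fst.
  exact: continuous_dotp.
split; first exact: (continuous_compR (@continuous_cos R) cL).
exact: (continuous_compR (@continuous_sin R) cL).
Qed.

Lemma is_cderive_character w k a :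
  dotp (int_vec R k) w.1 = a ->
  is_cderive w (character k) (fun p => (0 +i* (- a)) * character k p).
Proof.
move=> wa p; pose L (q : dom) := - dotp (int_vec R k) q.1.
have La (h : R) : L (h *: w + p) = h * (- a) + L p.
  by rewrite /L /= dotpDr dotpZr wa opprD mulrN.
split.
  apply: (is_derive_eq (is_derive_comp_affine La (is_derive_cos _))).
  by rewrite ReM /=; ring.
apply: (is_derive_eq (is_derive_comp_affine La (is_derive_sin _))).
by rewrite ImM /=; ring.
Qed.

Lemma ccontinuous_section h x : ccontinuous h -> ccontinuous (fun v => h (v, x)).
Proof.
move=> [c1 c2].
have cx : continuous (fun v : 'rV[R]_m => (v, x)).
  by apply: continuous_pair => v; [exact: cvg_id|exact: cst_continuous].
split=> v.
  by apply: (@continuous_comp _ _ _ (fun v => (v, x)) (fun q => complex.Re (h q)));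
    [exact: cx|exact: c1].
by apply: (@continuous_comp _ _ _ (fun v => (v, x)) (fun q => complex.Im (h q)));
  [exact: cx|exact: c2].
Qed.

Let quotient_section (phi : dom -> R) j v x :
  (fun r : R => r^-1 *: (phi (r *: delta_mx 0 j + v, x) - phi (v, x))) =
  (fun r : R => r^-1 *: (phi (r *: dir_t R n j + (v, x)) - phi (v, x))).
Proof.
apply/funext => r; congr (_ *: (phi _ - _)).
by congr pair => /=; rewrite scaler0 add0r.
Qed.

Lemma cubeint_derive_t_eq0 (phi : dom -> R) j x :
  continuous phi -> (forall p, derivable phi p (dir_t R n j)) ->
  continuous (fun p => 'D_(dir_t R n j) phi p) ->
  (forall p, phi (p + (2 * pi) *: dir_t R n j) = phi p) ->
  cubeint (fun v => 'D_(dir_t R n j) phi (v, x)) = 0.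
Proof.
move=> cphi dphi cD per.
have cx : continuous (fun v : 'rV[R]_m => (v, x)).
  by apply: continuous_pair => v; [exact: cvg_id|exact: cst_continuous].
have DE : (fun v => 'D_(dir_t R n j) phi (v, x)) =
    (fun v => 'D_(delta_mx 0 j) (fun v => phi (v, x)) v).
  by apply/funext => v; rewrite /derive quotient_section.
rewrite DE; apply: cubeint_derive_eq0.
- by move=> v; apply: (@continuous_comp _ _ _ (fun v => (v, x)) phi);
    [exact: cx|exact: cphi].
- by move=> v; have := dphi (v, x); rewrite /derivable quotient_section.
- rewrite -DE => v.
  by apply: (@continuous_comp _ _ _ (fun v => (v, x)) ('D_(dir_t R n j) phi));
    [exact: cx|exact: cD].
- move=> v; rewrite -(per (v, x)); congr phi.
  by congr pair => /=; rewrite scaler0 addr0.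
Qed.

Lemma periodic_character k : periodic_t (character k).
Proof.
move=> j p; have -> : character k (p + (2 * pi) *: dir_t R n j) =
    cexpi (- dotp (int_vec R k) p.1 + (- k 0 j)%:~R * (2 * pi)).
  rewrite /character/= dotpDr dotpZr dotp_delta mxE; congr cexpi.
  by rewrite mulrNz; ring.
rewrite /character /cexpi cosD2pi_int; congr Complex.
rewrite -!cosBpihalf addrAC; exact: cosD2pi_int.
Qed.

(** The function h(t, x) exp(-i k.t) is periodic, so its j-th derivative, given
    by the product rule, has integral 0. *)
Lemma fourier_coef_derive_t h j k x :
  ccontinuous h -> cderivable h (dir_t R n j) ->
  ccontinuous (cderive (dir_t R n j) h) -> periodic_t h ->
  fourier_coef (cderive (dir_t R n j) h) k x =
  (0 +i* (k 0 j)%:~R) * fourier_coef h k x.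
Proof.
move=> ch dh cD per.
set e := character k; set w := dir_t R n j.
have ce : ccontinuous e by exact: ccontinuous_character.
pose H (p : dom) := h p * e p.
pose H' (p : dom) := cderive w h p * e p + h p * ((0 +i* (- (k 0 j)%:~R)) * e p).
have dH : is_cderive w H H'.
  apply: is_cderiveM; first by apply/is_cderiveP.
  by apply: is_cderive_character; rewrite /= dotp_delta mxE.
have [derH HE] := (is_cderiveP _ _ _).1 dH.
have cH : ccontinuous H by exact: ccontinuousM.
have cH1 : ccontinuous (fun p => (0 +i* (- (k 0 j)%:~R)) * H p).
  by apply: ccontinuousM => //; exact: ccontinuous_cst.
have H'E : H' = (fun p => cderive w h p * e p + (0 +i* (- (k 0 j)%:~R)) * H p).
  by apply/funext => p; rewrite /H' /H; ring.
have cH0 : ccontinuous (fun p => cderive w h p * e p) by exact: ccontinuousM.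
have cH' : ccontinuous H' by rewrite H'E; exact: ccontinuousD.
have perH p : H (p + (2 * pi) *: w) = H p.
  by rewrite /H per; congr (_ * _); exact: periodic_character.
have I0 : cubeintC (fun v => H' (v, x)) = 0.
  have [cHr cHi] := cH; have := cH'; rewrite -HE => -[cHr' cHi'].
  apply: eq_ReIm => /=.
    transitivity (cubeint (fun v => 'D_w (fun q => complex.Re (H q)) (v, x))).
      by congr cubeint; apply/funext => v; rewrite -HE.
    apply: (cubeint_derive_t_eq0 x cHr (fun p => (derH p).1) cHr') => p.
    by rewrite perH.
  transitivity (cubeint (fun v => 'D_w (fun q => complex.Im (H q)) (v, x))).
    by congr cubeint; apply/funext => v; rewrite -HE.
  apply: (cubeint_derive_t_eq0 x cHi (fun p => (derH p).2) cHi') => p.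
  by rewrite perH.
move: I0; under [X in cubeintC X]eq_fun do rewrite H'E.
rewrite (cubeintCD (ccontinuous_section x cH0) (ccontinuous_section x cH1)).
rewrite (cubeintCZ _ (ccontinuous_section x cH)).
move=> /eqP; rewrite addr_eq0 => /eqP I0.
rewrite !fourier_coefE I0 mulrCA; congr (_ * _); rewrite -mulNr; congr (_ * _).
by apply: eq_ReIm; rewrite /= ?oppr0 ?opprK.
Qed.

Lemma is_cderive_fourier_coef h i k :
  ccontinuous h -> cderivable h (dir_x R m i) ->
  ccontinuous (cderive (dir_x R m i) h) ->
  is_cderive (delta_mx 0 i) (fourier_coef h k)
    (fourier_coef (cderive (dir_x R m i) h) k).
Proof.
move=> ch dh cD.
set e := character k; set w := dir_x R m i.
have ce : ccontinuous e by exact: ccontinuous_character.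
pose H (p : dom) := h p * e p.
have dH : is_cderive w H (fun p => cderive w h p * e p).
  have de : is_cderive w e (fun p => 0).
    have := @is_cderive_character w k 0; rewrite /= oppr0.
    under [X in is_cderive _ _ X]eq_fun do rewrite mul0r.
    by apply; rewrite /dotp big1// => j _; rewrite !mxE mulr0.
  have := is_cderiveM ((is_cderiveP _ _ _).2 (conj dh erefl)) de.
  by congr is_cderive; apply/funext => p; rewrite mulr0 addr0.
have [derH HE] := (is_cderiveP _ _ _).1 dH.
have [cHr cHi] : ccontinuous H by apply: ccontinuousM.
have [cDr cDi] : ccontinuous (cderive w H) by rewrite HE; exact: ccontinuousM.
apply: is_cderiveZ => x.
have dR p : derivable (fun q => complex.Re (H q)) p w := (derH p).1.
have dI p : derivable (fun q => complex.Im (H q)) p w := (derH p).2.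
split; split.
- exact: (derivable_cubeint cHr dR cDr).
- transitivity (cubeint (fun v => complex.Re (cderive w H (v, x)))).
    exact: (derive_cubeint cHr dR cDr).
  by rewrite HE.
- exact: (derivable_cubeint cHi dI cDi).
- transitivity (cubeint (fun v => complex.Im (cderive w H (v, x)))).
    exact: (derive_cubeint cHi dI cDi).
  by rewrite HE.
Qed.

Lemma periodic_cderive w h : periodic_t h -> periodic_t (cderive w h).
Proof.
move=> per j p.
have E (F : R[i] -> R) : 'D_w (fun q => F (h q)) (p + (2 * pi) *: dir_t R n j) =
    'D_w (fun q => F (h q)) p.
  have Q : (fun r : R => r^-1 *: (F (h (r *: w + (p + (2 * pi) *: dir_t R n j)))
        - F (h (p + (2 * pi) *: dir_t R n j)))) =
      (fun r : R => r^-1 *: (F (h (r *: w + p)) - F (h p))).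
    by apply/funext => r; rewrite addrA !per.
  by rewrite /derive Q.
by apply: eq_ReIm; exact: E.
Qed.

End fourier_derivatives.

Section fourier_mderive.
Context {R : realType} {m n : nat}.
Local Notation dom := ('rV[R]_m * 'rV[R]_n)%type.
Implicit Types (f : dom -> R[i]) (k : 'rV[int]_m).

Lemma smooth_torus_cderive f i :
  smooth_torus f -> smooth_torus (cderive (dir R i) f).
Proof.
move=> [per sm]; split; first exact: periodic_cderive.
by move=> s; have := sm (rcons s i); rewrite foldr_rcons.
Qed.

Lemma smooth_torus_iter f i l :
  smooth_torus f -> smooth_torus (iter l (cderive (dir R i)) f).
Proof.
move=> sm; elim: l => [|l IH]; first exact: sm.
exact: (smooth_torus_cderive i IH).
Qed.

Lemma smooth_torus_foldr (I : Type) (e : I -> 'I_m + 'I_n) (c : I -> nat) s f :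
  smooth_torus f ->
  smooth_torus (foldr (fun i h => iter (c i) (cderive (dir R (e i))) h) f s).
Proof.
move=> sm; elim: s => [|i s IH]; first exact: sm.
exact: (smooth_torus_iter (e i) (c i) IH).
Qed.

Lemma smooth_torus_mderive_t c f : smooth_torus f ->
  smooth_torus (mderive (@dir_t R m n) c f).
Proof. exact: (@smooth_torus_foldr _ inl (c ord0)). Qed.

Lemma smooth_torus_mderive_x b f : smooth_torus f ->
  smooth_torus (mderive (@dir_x R m n) b f).
Proof. exact: (@smooth_torus_foldr _ inr (b ord0)). Qed.

Lemma ccontinuous_smooth f : smooth_torus f -> ccontinuous f.
Proof. by move=> [_ /(_ [::])[]]. Qed.

Lemma fourier_coef_cderive_t f j k : smooth_torus f ->
  fourier_coef (cderive (dir_t R n j) f) k =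
  (fun x => (0 +i* (k 0 j)%:~R) * fourier_coef f k x).
Proof.
move=> sm; have [per _] := sm; apply/funext => x.
apply: fourier_coef_derive_t => //; first exact: ccontinuous_smooth.
  by have [_ /(_ [::])[_ /(_ (inl j))]] := sm.
exact: (ccontinuous_smooth (smooth_torus_cderive (inl j) sm)).
Qed.

Lemma fourier_coef_iter_t f j l k : smooth_torus f ->
  fourier_coef (iter l (cderive (dir_t R n j)) f) k =
  (fun x => (0 +i* (k 0 j)%:~R) ^+ l * fourier_coef f k x).
Proof.
move=> sm; elim: l => [|l IH] /=.
  by apply/funext => x; rewrite expr0 mul1r.
rewrite fourier_coef_cderive_t; last exact: (@smooth_torus_iter _ (inl j)).
by rewrite IH; apply/funext => x; rewrite exprS mulrA.
Qed.

Lemma fourier_coef_mderive_t f c k : smooth_torus f ->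
  fourier_coef (mderive (@dir_t R m n) c f) k =
  (fun x => (\prod_j (0 +i* (k 0 j)%:~R) ^+ c 0 j) * fourier_coef f k x).
Proof.
move=> sm; rewrite /mderive -big_enum/=.
elim: (enum 'I_m) => [|j s IH] /=.
  by apply/funext => x; rewrite big_nil mul1r.
rewrite fourier_coef_iter_t; last exact: (@smooth_torus_foldr _ inl (c ord0)).
by rewrite IH; apply/funext => x; rewrite big_cons mulrA.
Qed.

Lemma cderive_fourier_coefZ f i k (z : R[i]) : smooth_torus f ->
  cderive (delta_mx 0 i) (fun x => z * fourier_coef f k x) =
  (fun x => z * fourier_coef (cderive (dir_x R m i) f) k x).
Proof.
move=> sm.
suff /(is_cderiveZ z)/is_cderiveP[] : is_cderive (delta_mx 0 i) (fourier_coef f k)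
  (fourier_coef (cderive (dir_x R m i) f) k) by [].
apply: is_cderive_fourier_coef; first exact: ccontinuous_smooth.
  by have [_ /(_ [::])[_ /(_ (inr i))]] := sm.
exact: (ccontinuous_smooth (smooth_torus_cderive (inr i) sm)).
Qed.

Lemma mderive_fourier_coefZ f b k (z : R[i]) : smooth_torus f ->
  mderive (fun i : 'I_n => delta_mx 0 i) b (fun x => z * fourier_coef f k x) =
  (fun x => z * fourier_coef (mderive (@dir_x R m n) b f) k x).
Proof.
move=> sm; rewrite /mderive; elim: (enum 'I_n) => //= i s ->.
have : smooth_torus (foldr
    (fun i h => iter (b ord0 i) (cderive (dir_x R m i)) h) f s).
  exact: (@smooth_torus_foldr _ inr (b ord0)).
move: (foldr _ _ s) => h smh; elim: (b ord0 i) => //= l ->.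
by rewrite (cderive_fourier_coefZ _ _ _ (smooth_torus_iter (inr i) l smh)).
Qed.

Lemma mderive_fourier_coef f b k : smooth_torus f ->
  mderive (fun i : 'I_n => delta_mx 0 i) b (fourier_coef f k) =
  fourier_coef (mderive (@dir_x R m n) b f) k.
Proof.
move=> sm; have := mderive_fourier_coefZ b k 1 sm.
have E h : (fun x => 1 * fourier_coef h k x) = fourier_coef h k.
  by apply/funext => x; rewrite mul1r.
by rewrite !E.
Qed.

Lemma fourier_coef_mderive f b c k x : smooth_torus f ->
  fourier_coef (mderive (@dir_x R m n) b (mderive (@dir_t R m n) c f)) k x =
  (\prod_j (0 +i* (k 0 j)%:~R) ^+ c 0 j) *
    mderive (fun i : 'I_n => delta_mx 0 i) b (fourier_coef f k) x.
Proof.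
move=> sm; rewrite -mderive_fourier_coef; last exact: smooth_torus_mderive_t.
by rewrite fourier_coef_mderive_t// mderive_fourier_coefZ// mderive_fourier_coef.
Qed.

End fourier_mderive.

(** * Moments and exponential decay *)

Section exponential_bounds.
Context {R : realType}.
Implicit Types (u v y Q B C S : R).

(** exp(u/2) is the sum of the 2^-N u^N/N!, hence at most 2 sup_N u^N/N!. *)
Lemma expR_half_le u S : 0 <= u -> (forall N, u ^+ N <= S * N`!%:R) ->
  expR (u / 2) <= 2 * S.
Proof.
move=> u0 uS; apply: limr_le; first exact: is_cvg_series_exp_coeff.
have S0 : 0 <= S by have := uS 0%N; rewrite expr0 fact0 mulr1; apply: le_trans.
apply: nearW => N; rewrite /series/=.
suff h : \sum_(0 <= k < N) exp_coeff (u / 2) k <= 2 * S - 2 * S * 2^-1 ^+ N.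
  by apply: (le_trans h); rewrite lerBlDr lerDl !mulr_ge0// exprn_ge0.
elim: N => [|N IH]; first by rewrite big_nil expr0 mulr1 subrr.
rewrite big_nat_recr//=; apply: (le_trans (lerD IH (_ : _ <= S * 2^-1 ^+ N))).
  rewrite /exp_coeff /= expr_div_n -exprVn mulrAC ler_wpM2r ?exprn_ge0//.
  by rewrite ler_pdivrMr ?ltr0n ?fact_gt0.
by rewrite exprSr le_eqVlt; apply/orP; left; apply/eqP; field.
Qed.

Lemma exprn_le_expR v N : 0 <= v -> v ^+ N <= N`!%:R * expR v.
Proof.
move=> v0; rewrite mulrC -ler_pdivrMr ?ltr0n ?fact_gt0//.
have mono : {homo series (exp_coeff v) : a b / (a <= b)%N >-> a <= b}.
  apply/nondecreasing_seqP => a; rewrite seriesSr lerDl /exp_coeff /=.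
  by rewrite divr_ge0 ?exprn_ge0.
apply: le_trans (nondecreasing_cvgn_le mono (is_cvg_series_exp_coeff v) N.+1).
rewrite seriesSr lerDr /series/= sumr_ge0// => i _.
by rewrite /exp_coeff /= divr_ge0 ?exprn_ge0.
Qed.

(** The moment bounds say that u = (y/C)^(1/sigma) satisfies
    u^N <= (B/Q)^(1/sigma) N! for every N. *)
Lemma expR_decay_of_moments (sigma : R) y Q B C : 0 < sigma -> 0 < C ->
  0 <= y -> 0 <= Q ->
  (forall N, y ^+ N * Q <= B * C ^+ N * N`!%:R `^ sigma) ->
  expR (sigma / 2 * C^-1 `^ (1 / sigma) * y `^ (1 / sigma)) * Q <=
  2 `^ sigma * B.
Proof.
move=> s0 C0 y0; rewrite le_eqVlt => /orP[/eqP<- h|Q0 h].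
  have := h 0%N; rewrite !expr0 fact0 powR1 !mulr1 mulr0 => B0.
  by rewrite mulr0 mulr_ge0// powR_ge0.
have B0 : 0 <= B.
  by have := h 0%N; rewrite !expr0 fact0 powR1 !mulr1 mul1r; apply: le_trans; exact: ltW.
set r := 1 / sigma; have r0 : 0 < r by rewrite divr_gt0.
have rs : r * sigma = 1 by rewrite /r mul1r mulVf ?gt_eqF.
pose u := (y / C) `^ r; pose S := (B / Q) `^ r.
have yC0 : 0 <= y / C by rewrite divr_ge0// ltW.
have BQ0 : 0 <= B / Q by rewrite divr_ge0// ltW.
have uS N : u ^+ N <= S * N`!%:R.
  have -> : u ^+ N = ((y / C) ^+ N) `^ r.
    by rewrite -(powR_mulrn N yC0) -powRrM [N%:R * r]mulrC powRrM
      (powR_mulrn N (powR_ge0 _ _)).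
  have -> : S * N`!%:R = (B / Q * N`!%:R `^ sigma) `^ r.
    rewrite powRM ?powR_ge0// -powRrM [sigma * r]mulrC rs powRr1//.
  apply: (ge0_ler_powR (ltW r0)).
  - by rewrite nnegrE exprn_ge0.
  - by rewrite nnegrE mulr_ge0 ?powR_ge0.
  rewrite expr_div_n ler_pdivrMr ?exprn_gt0// -(ler_pM2r Q0).
  apply: le_trans (h N) _; rewrite le_eqVlt; apply/orP; left; apply/eqP.
  by field; rewrite gt_eqF.
have := expR_half_le (powR_ge0 _ _ : 0 <= u) uS.
have -> : sigma / 2 * C^-1 `^ r * y `^ r = u / 2 * sigma.
  by rewrite /u powRM ?invr_ge0 ?(ltW C0)//; field.
move=> /(ge0_ler_powR (ltW s0)); rewrite !nnegrE expR_ge0 mulr_ge0 ?powR_ge0//.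
move=> /(_ isT isT); rewrite -expRM powRM ?powR_ge0// /S -powRrM rs powRr1//.
by rewrite mulrA -ler_pdivlMr.
Qed.

(** One half of the exponential absorbs y^N, the other half the polynomial
    factor that makes the weights summable. *)
Lemma moments_of_expR_decay (sigma delta : R) : 1 <= sigma -> 0 < delta ->
  exists K D : R, [/\ 0 < K, 0 < D & forall y N, 0 <= y ->
    y ^+ N * ((y + 1) * (y + 2)) <=
    K * D ^+ N * N`!%:R `^ sigma * expR (delta * y `^ (1 / sigma))].
Proof.
move=> s1 d0; have s0 : 0 < sigma by exact: lt_le_trans s1.
set r := 1 / sigma; have r0 : 0 < r by rewrite divr_gt0.
have rs : r * sigma = 1 by rewrite /r mul1r mulVf ?gt_eqF.
(* a is chosen so that (exp v)^sigma = exp(delta/2 y^(1/sigma)) for v = a y^(1/sigma) *)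
have [a a0 aE] : exists2 a, 0 < a & a * sigma = delta / 2.
  by exists (delta / 2 / sigma); [rewrite !divr_gt0|rewrite divfK ?gt_eqF].
pose D := a^-1 `^ sigma; have D0 : 0 < D by rewrite powR_gt0// invr_gt0.
pose E y := expR (delta / 2 * y `^ r).
have half y N : 0 <= y -> y ^+ N <= D ^+ N * N`!%:R `^ sigma * E y.
  move=> y0; set v := a * y `^ r.
  have v0 : 0 <= v by rewrite mulr_ge0 ?powR_ge0// ltW.
  have Ne0 : 0 <= N`!%:R * expR v by rewrite mulr_ge0 ?expR_ge0.
  have := ge0_ler_powR (ltW s0) (exprn_ge0 N v0) Ne0 (exprn_le_expR N v0).
  rewrite powRM ?expR_ge0// -expRM.
  have -> : (v ^+ N) `^ sigma = (v `^ sigma) ^+ N.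
    by rewrite -(powR_mulrn N v0) -powRrM [N%:R * sigma]mulrC powRrM
      (powR_mulrn N (powR_ge0 _ _)).
  have -> : v `^ sigma = a `^ sigma * y.
    by rewrite /v powRM ?powR_ge0 ?(ltW a0)// -powRrM rs powRr1.
  have -> : v * sigma = delta / 2 * y `^ r by rewrite /v mulrAC aE.
  rewrite exprMn -/(E y) => H.
  have aD : a `^ sigma * D = 1.
    by rewrite /D -powRM ?invr_ge0 ?(ltW a0)// divff ?gt_eqF// powR1.
  have -> : y ^+ N = D ^+ N * ((a `^ sigma) ^+ N * y ^+ N).
    by rewrite mulrA -exprMn [D * _]mulrC aD expr1n mul1r.
  by rewrite -[leRHS]mulrA ler_wpM2l// exprn_ge0// ltW.
exists (4 * (1 + D ^+ 2 * 2 `^ sigma)), D; split => // [|y N y0].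
  by rewrite mulr_gt0// ltr_wpDr// mulr_ge0 ?powR_ge0// exprn_ge0// ltW.
have -> : expR (delta * y `^ r) = E y * E y.
  by rewrite /E -expRD; congr expR; field.
have E1 : 1 <= E y.
  by rewrite /E -expR0 ler_expR mulr_ge0 ?powR_ge0// divr_ge0// ltW.
have h2 := half y 2%N y0; have hN := half y N y0.
rewrite (_ : 2`! = 2)%N// in h2.
have q : (y + 1) * (y + 2) <= 4 * (1 + D ^+ 2 * 2 `^ sigma) * E y.
  apply: (@le_trans _ _ (4 * (1 + y ^+ 2))); first by nra.
  by rewrite -mulrA ler_wpM2l// mulrDl mul1r lerD.
apply: le_trans (ler_pM _ _ hN q) _; rewrite ?exprn_ge0//.
  by rewrite mulr_ge0// addr_ge0.
by rewrite le_eqVlt; apply/orP; left; apply/eqP; ring.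
Qed.

End exponential_bounds.

Section weights.
Context {R : realType}.

(** A summable weight on the integers whose partial sums telescope. *)
Definition weight (k : int) : R := ((`|k|%:R + 1) * (`|k|%:R + 2))^-1.

Lemma weight_ge0 k : 0 <= weight k.
Proof. by rewrite invr_ge0 mulr_ge0// addr_ge0. Qed.

Lemma weightE (d : nat) : weight d = (d.+1%:R)^-1 - (d.+2%:R)^-1.
Proof.
rewrite /weight absz_nat -(natr1 d.+1) -(natr1 d); have : 0 <= d%:R :> R by [].
by move=> d0; field; apply/andP; split; lra.
Qed.

Lemma weightN k : weight (- k) = weight k.
Proof. by rewrite /weight abszN. Qed.

Lemma sum_weight_le2 N (p : 'I_N) : \sum_(q < N) weight (p%:Z - q%:Z) <= 2.
Proof.
pose A M := \sum_(0 <= q < M) weight (p%:Z - q%:Z).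
have AS M : A M.+1 = A M + weight (p%:Z - M%:Z) by rewrite /A big_nat_recr.
(* closed bounds for the partial sums, before and after the index p *)
have A1 M : (M <= p)%N -> A M <= ((p - M).+2%:R)^-1.
  elim: M => [|M IH] Mp; first by rewrite /A big_nil invr_ge0.
  rewrite AS subzn ?(ltnW Mp)// weightE.
  have := IH (ltnW Mp); rewrite (subnSK Mp).
  move: (A M) ((p - M).+1%:R^-1) ((p - M).+2%:R^-1) => x y z; lra.
have A2 M : A (p + M)%N <= 2 - (M.+1%:R)^-1.
  elim: M => [|M IH].
    rewrite addn0 invr1; have := A1 p (leqnn p); rewrite subnn.
    have : (2%:R : R)^-1 <= 1 by rewrite invf_le1 ?ler1n.
    by move: (A p) => x; lra.
  rewrite addnS AS -weightN opprB PoszD addrAC subrr add0r weightE.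
  by move: IH; move: (A (p + M)%N) (M.+1%:R^-1) (M.+2%:R^-1) => x y z; lra.
have -> : \sum_(q < N) weight (p%:Z - q%:Z) = A N by rewrite /A big_mkord.
rewrite -(subnKC (ltnW (ltn_ord p))); apply: (le_trans (A2 _)).
by rewrite gerBl invr_ge0.
Qed.

End weights.

(** * Pointwise bounds for complex functions *)

Section sup_bound_complex.
Context {R : realType} {m : nat} (g : 'rV[R]_m -> R[i]) (u : 'rV[R]_m) (A : R).
Hypotheses (cg : ccontinuous g) (A0 : 0 <= A).
Hypothesis perg : forall j v, g (v + (2 * pi) *: delta_mx 0 j) = g v.
Hypothesis gA : forall l : 'rV[int]_m,
  Normc.normc (cubeintC (fun v => g v * cexpi (- dotp (int_vec R l) v))) <=
  (2 * pi) ^+ m * (A * \prod_j weight (l 0 j)).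

Let hat (l : 'rV[int]_m) := cubeintC (fun v => g v * cexpi (- dotp (int_vec R l) v)).

Let cexpi_hat (l : 'rV[int]_m) : ccontinuous (fun v => g v * cexpi (- dotp (int_vec R l) v)).
Proof.
apply: ccontinuousM => //; split.
  apply: continuous_compR; first exact: continuous_cos.
  by apply: continuous_opp; exact: continuous_dotp.
apply: continuous_compR; first exact: continuous_sin.
by apply: continuous_opp; exact: continuous_dotp.
Qed.

Let dotpN (l : 'rV[int]_m) (v : 'rV[R]_m) :
  dotp (int_vec R (- l)) v = - dotp (int_vec R l) v.
Proof. by rewrite /dotp -sumrN; apply: eq_bigr => j _; rewrite !mxE intrN mulNr. Qed.

(* the cosine is the mean of two conjugate characters *)
Let hat_cos l : cubeintC (fun v => g v * (cos (dotp (int_vec R l) (v - u)))%:C) =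
  (2^-1)%:C * (cexpi (dotp (int_vec R l) u) * hat l +
    cexpi (- dotp (int_vec R l) u) * hat (- l)).
Proof.
have cZ z l' : ccontinuous (fun v => z * (g v * cexpi (- dotp (int_vec R l') v))).
  by apply: ccontinuousM => //; exact: ccontinuous_cst.
rewrite -!cubeintCZ// -cubeintCD// -cubeintCZ; last exact: ccontinuousD.
congr cubeintC; apply/funext => v.
rewrite dotpN opprK -scaleN1r dotpDr dotpZr mulN1r cosB /cexpi !cosN !sinN.
case: (g v) => a b; by apply: eq_ReIm; rewrite /= ?ReM ?ImM /=; field.
Qed.

(* P stands for the real or the imaginary part *)
Let hat_bound (l : 'rV[int]_m) (P : R[i] -> R) :
  (forall z, `|P z| <= Normc.normc z) ->
  (forall z z', P (z + z') = P z + P z') -> (forall (r : R) z, P (r%:C * z) = r * P z) ->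
  `|P (cubeintC (fun v => g v * (cos (dotp (int_vec R l) (v - u)))%:C))| <=
  (2 * pi) ^+ m * (A * \prod_j weight (l 0 j)).
Proof.
move=> Pn PD PZ; rewrite hat_cos PZ PD normrM ger0_norm ?invr_ge0//.
rewrite ler_pdivrMl//; apply: (le_trans (ler_normD _ _)).
set X := _ ^+ m * _; have -> : 2 * X = X + X by ring.
rewrite /X; apply: lerD; apply: (le_trans (Pn _)).
  by rewrite Normc.normcM normc_cexpi mul1r; exact: gA.
rewrite Normc.normcM normc_cexpi mul1r; apply: (le_trans (gA _)).
rewrite le_eqVlt; apply/orP; left; apply/eqP; congr (_ * (_ * _)).
by apply: eq_bigr => j _; rewrite mxE weightN.
Qed.

Let ler_part (F : 'rV[R]_m -> R) : continuous F ->
  (forall j v, F (v + (2 * pi) *: delta_mx 0 j) = F v) ->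
  (forall l : 'rV[int]_m,
    `|cubeint (fun v => F v * cos (dotp (int_vec R l) (v - u)))| <=
    (2 * pi) ^+ m * (A * \prod_j weight (l 0 j))) ->
  `|F u| <= A * 2 ^+ m.
Proof.
move=> cF perF HF; rewrite ler_norml lerNl; apply/andP; split.
  apply: (@ler_of_fourier _ _ (fun v => - F v) u weight A 2) => //.
  - exact: continuous_opp.
  - by move=> j v; rewrite perF.
  - exact: weight_ge0.
  - exact: sum_weight_le2.
  - move=> l; have -> : (fun v => - F v * cos (dotp (int_vec R l) (v - u))) =
        (fun v => -1 * (F v * cos (dotp (int_vec R l) (v - u)))).
      by apply/funext => v; rewrite mulN1r mulNr.
    rewrite cubeintZ ?mulN1r ?normrN//; apply: continuous_mul => //.
    by apply: continuous_trig_dotp; exact: continuous_cos.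
apply: (@ler_of_fourier _ _ F u weight A 2) => //.
- exact: weight_ge0.
- exact: sum_weight_le2.
Qed.

Lemma ler_normc_of_fourier : Normc.normc (g u) <= 2 * (A * 2 ^+ m).
Proof.
have [cg1 cg2] := cg; apply: (le_trans (ler_normc_ReIm _)).
rewrite mulr_natl mulr2n; apply: lerD.
  apply: (ler_part (F := fun v => complex.Re (g v))) => // [j v|l].
    by rewrite perg.
  have -> : cubeint (fun v => complex.Re (g v) * cos (dotp (int_vec R l) (v - u))) =
      complex.Re (cubeintC (fun v => g v * (cos (dotp (int_vec R l) (v - u)))%:C)).
    by congr cubeint; apply/funext => v; rewrite ReM /= mulr0 subr0.
  apply: hat_bound; [exact: ler_Re_normc|by case=> ? ? [] ? ?|move=> r [a b] /=].
  by rewrite mul0r subr0.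
apply: (ler_part (F := fun v => complex.Im (g v))) => // [j v|l].
  by rewrite perg.
have -> : cubeint (fun v => complex.Im (g v) * cos (dotp (int_vec R l) (v - u))) =
    complex.Im (cubeintC (fun v => g v * (cos (dotp (int_vec R l) (v - u)))%:C)).
  by congr cubeint; apply/funext => v; rewrite ImM /= mulr0 add0r.
apply: hat_bound; [exact: ler_Im_normc|by case=> ? ? [] ? ?|move=> r [a b] /=].
by rewrite mul0r addr0.
Qed.

End sup_bound_complex.

(** * Euclidean norm of the frequencies *)

Section euclidean_norm.
Context {R : realType} {m : nat}.
Implicit Type x : 'rV[R]_m.

Lemma ler_coord_eucl_norm x j : `|x 0 j| <= eucl_norm x.
Proof.
rewrite -sqrtr_sqr ler_sqrt ?sumr_ge0// => [|i _]; last exact: sqr_ge0.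
by rewrite (bigD1 j)//= lerDl sumr_ge0// => i _; exact: sqr_ge0.
Qed.

Lemma eucl_norm_ge0 x : 0 <= eucl_norm x.
Proof. exact: sqrtr_ge0. Qed.

Lemma eucl_norm0 : eucl_norm (0 : 'rV[R]_m) = 0.
Proof. by rewrite /eucl_norm big1 ?sqrtr0// => i _; rewrite mxE expr0n. Qed.

Lemma ler_eucl_norm_coord x j : (forall i, `|x 0 i| <= `|x 0 j|) ->
  eucl_norm x <= m%:R * `|x 0 j|.
Proof.
move=> xj; rewrite -[leRHS]ger0_norm ?mulr_ge0// -sqrtr_sqr ler_sqrt ?sqr_ge0//.
apply: (@le_trans _ _ (\sum_(i < m) `|x 0 j| ^+ 2)).
  apply: ler_sum => i _; rewrite -[x 0 i ^+ 2]real_normK ?num_real//.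
  by rewrite lerXn2r ?nnegrE.
rewrite sumr_const card_ord -[_ ^+ 2 *+ m]mulr_natl exprMn ler_wpM2r ?sqr_ge0//.
by rewrite -natrX ler_nat; case: (m) => // p; rewrite expnS expn1 leq_pmulr.
Qed.

(** The divisor is m + 1 rather than m, so as to be positive even for m = 0. *)
Lemma prod_expR_eucl_norm x (eps r : R) : 0 < eps -> 0 < r ->
  \prod_j expR (eps / m.+1%:R * `|x 0 j| `^ r) <= expR (eps * eucl_norm x `^ r).
Proof.
move=> e0 r0; rewrite -expR_sum ler_expR.
apply: (@le_trans _ _ (\sum_(j < m) eps / m.+1%:R * eucl_norm x `^ r)).
  apply: ler_sum => j _; rewrite ler_wpM2l//; first by rewrite divr_ge0 ?ltW.
  apply: ge0_ler_powR; rewrite ?nnegrE ?eucl_norm_ge0 ?(ltW r0)//.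
  exact: ler_coord_eucl_norm.
rewrite sumr_const card_ord -[_ *+ m]mulr_natl mulrA ler_wpM2r ?powR_ge0//.
rewrite mulrCA ger_pMr// ler_pdivrMr ?ltr0n// mul1r ler_nat//.
Qed.

End euclidean_norm.

(** * The two implications *)

Section characterization.
Context {R : realType} {m n : nat} (sigma mu : R).
Hypothesis sigma_ge1 : 1 <= sigma.
Local Notation dom := ('rV[R]_m * 'rV[R]_n)%type.
Implicit Types (f : dom -> R[i]) (k : 'rV[int]_m) (a b : 'rV[nat]_n) (c : 'rV[nat]_m).

(** The factor (a! b!)^mu common to both families of estimates. *)
Definition factorial_weight a b : R := (midx_fact a * midx_fact b)%:R `^ mu.

Let sigma_gt0 : 0 < sigma. Proof. exact: lt_le_trans sigma_ge1. Qed.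

Lemma midx_fact_gt0 p (a : 'rV[nat]_p) : (0 < midx_fact a)%N.
Proof. by rewrite prodn_gt0// => i; exact: fact_gt0. Qed.

Lemma factorial_weight_gt0 a b : 0 < factorial_weight a b.
Proof. by rewrite powR_gt0// ltr0n muln_gt0 !midx_fact_gt0. Qed.

(** The estimates defining the Gelfand-Shilov space, without suprema. *)
Definition GS_bound f (M C : R) := forall a b c (p : dom),
  Normc.normc ((monom p.2 a)%:C * mderive (@dir_x R m n) b (mderive (@dir_t R m n) c f) p)
  <= M * (C ^+ (midx_abs (a + b)%R + midx_abs c) * (midx_fact c)%:R `^ sigma *
     factorial_weight a b).

(** The decay estimates on the Fourier coefficients, without suprema. *)
Definition fourier_bound f (C0 C1 eps : R) := forall a b k (x : 'rV[R]_n),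
  expR (eps * eucl_norm (int_vec R k) `^ (1 / sigma)) *
  Normc.normc ((monom x a)%:C *
    mderive (fun i : 'I_n => delta_mx 0 i) b (fourier_coef f k) x)
  <= C0 * C1 ^+ midx_abs (a + b)%R * factorial_weight a b.

Let GS_coef (C : R) a b c : R := C ^- (midx_abs (a + b)%R + midx_abs c)
  * ((midx_fact c)%:R `^ (- sigma)) * ((midx_fact a * midx_fact b)%:R `^ (- mu)).

Let GS_coefE C a b c : GS_coef C a b c = (C ^+ (midx_abs (a + b)%R + midx_abs c) *
  (midx_fact c)%:R `^ sigma * factorial_weight a b)^-1.
Proof. by rewrite /GS_coef !powRN !invfM. Qed.

Lemma GS_space_constP f C : 0 < C ->
  GS_space_const sigma mu C f <->
  smooth_torus f /\ exists2 M, 0 < M & GS_bound f M C.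
Proof.
move=> C0.
have D0 a b c : 0 < C ^+ (midx_abs (a + b)%R + midx_abs c) *
    (midx_fact c)%:R `^ sigma * factorial_weight a b.
  by rewrite !mulr_gt0 ?exprn_gt0 ?factorial_weight_gt0// powR_gt0// ltr0n midx_fact_gt0.
split=> -[sm].
  move=> Soo; split => //.
  set S := ereal_sup _ in Soo.
  have [M M0 SM] : exists2 M : R, 0 < M & (S <= M%:E)%E.
    move: Soo; case: (S) => [r _|//|_].
      exists (`|r| + 1); first by rewrite ltr_wpDl.
      by rewrite lee_fin; apply: (le_trans (ler_norm _)); rewrite lerDl.
    by exists 1 => //; rewrite leNye.
  exists M => // a b c p.
  rewrite -ler_pdivrMr; last exact: D0.
  rewrite mulrC -GS_coefE -lee_fin; apply: le_trans SM.
  apply: (le_trans _ (ereal_sup_ubound (ex_intro2 _ _ (a, b, c) I erefl))).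
  rewrite EFinM; apply: lee_wpmul2l.
    by rewrite lee_fin GS_coefE invr_ge0 ltW.
  by apply: ereal_sup_ubound; exists p.
move=> [M M0 fM]; split => //; apply: (@le_lt_trans _ _ M%:E); last exact: ltry.
apply: ge_ereal_sup => _ [[[a b] c] _ <-].
rewrite -/(GS_coef C a b c).
have coef0 : 0 <= GS_coef C a b c by rewrite GS_coefE invr_ge0 ltW.
apply: (@le_trans _ _ ((GS_coef C a b c)%:E * (M * (GS_coef C a b c)^-1)%:E)%E).
  apply: lee_wpmul2l; first by rewrite lee_fin.
  apply: ge_ereal_sup => _ [p _ <-].
  by rewrite lee_fin GS_coefE invrK; exact: fM.
by rewrite -EFinM lee_fin mulrCA divff ?mulr1// GS_coefE invr_eq0 gt_eqF.
Qed.

Lemma monom_fourier_coef f a b c k x : smooth_torus f ->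
  (\prod_j (0 +i* (k 0 j)%:~R) ^+ c 0 j) * ((monom x a)%:C *
    mderive (fun i : 'I_n => delta_mx 0 i) b (fourier_coef f k) x) =
  ((2 * pi) ^- m)%:C * cubeintC (fun v => (monom x a)%:C *
    mderive (@dir_x R m n) b (mderive (@dir_t R m n) c f) (v, x) *
    cexpi (- dotp (int_vec R k) v)).
Proof.
move=> sm; rewrite mulrCA -fourier_coef_mderive// fourier_coefE mulrCA.
congr (_ * _); rewrite -cubeintCZ.
  by congr cubeintC; apply/funext => v; rewrite mulrA.
apply: (@ccontinuous_section _ _ _ (fun p => mderive (@dir_x R m n) b
  (mderive (@dir_t R m n) c f) p * character k p)).
apply: ccontinuousM; last exact: ccontinuous_character.
by apply: ccontinuous_smooth; apply: smooth_torus_mderive_x; exact: smooth_torus_mderive_t.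
Qed.

Lemma normc_prod_imag k c :
  Normc.normc (\prod_j (0 +i* (k 0 j)%:~R) ^+ c 0 j : R[i]) =
  \prod_j `|int_vec R k 0 j| ^+ c 0 j.
Proof.
rewrite normc_prod; apply: eq_bigr => j _.
by rewrite normcX normc_imag mxE.
Qed.

Let ccontinuous_monom_mderive f a b c x : smooth_torus f ->
  ccontinuous (fun v : 'rV[R]_m => (monom x a)%:C *
    mderive (@dir_x R m n) b (mderive (@dir_t R m n) c f) (v, x)).
Proof.
move=> sm; apply: ccontinuousM; first exact: ccontinuous_cst.
apply: ccontinuous_section; apply: ccontinuous_smooth.
by apply: smooth_torus_mderive_x; exact: smooth_torus_mderive_t.
Qed.

Let ccontinuous_cexpi k : ccontinuous (fun v => cexpi (- dotp (int_vec R k) v)).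
Proof. exact: (@ccontinuous_section _ _ n (character k) 0 (ccontinuous_character k)). Qed.

(** A sup bound on x^a d_x^b d_t^c f bounds the moment k^c of the coefficients. *)
Lemma fourier_bound_moments f (M C : R) : smooth_torus f -> GS_bound f M C ->
  forall a b c k x,
  (\prod_j `|int_vec R k 0 j| ^+ c 0 j) * Normc.normc ((monom x a)%:C *
    mderive (fun i : 'I_n => delta_mx 0 i) b (fourier_coef f k) x) <=
  2 * (M * (C ^+ (midx_abs (a + b)%R + midx_abs c) * (midx_fact c)%:R `^ sigma *
     factorial_weight a b)).
Proof.
move=> sm fM a b c k x.
rewrite -normc_prod_imag -Normc.normcM (monom_fourier_coef a b c k x sm).
have T0 : 0 < (2 * pi) ^+ m :> R by rewrite exprn_gt0// twopi_gt0.
rewrite Normc.normcM normcR ger0_norm ?invr_ge0 ?(ltW T0)//.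
rewrite ler_pdivrMl// [leRHS]mulrC.
apply: ler_normc_cubeintC.
  by apply: ccontinuousM; [exact: ccontinuous_monom_mderive|exact: ccontinuous_cexpi].
by move=> v _; rewrite Normc.normcM normc_cexpi mulr1; exact: (fM a b c (v, x)).
Qed.

Lemma fourier_bound_of_GS f (M C : R) : smooth_torus f -> 0 < M -> 0 < C ->
  GS_bound f M C ->
  fourier_bound f (2 `^ sigma * (2 * M)) C
    (sigma / 2 * C^-1 `^ (1 / sigma) / m.+1%:R `^ (1 / sigma)).
Proof.
move=> sm M0 C0 fM a b k x.
set Q := Normc.normc _; have Q0 : 0 <= Q by exact: normc_ge0.
have := fourier_bound_moments sm fM a b _ k x; rewrite -/Q => mom.
set r := 1 / sigma.
have r0 : 0 < r by rewrite divr_gt0.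
set P := C ^+ midx_abs (a + b)%R * factorial_weight a b.
have P0 : 0 < P by rewrite mulr_gt0 ?exprn_gt0 ?factorial_weight_gt0.
pose B := 2 * M * P; have B0 : 0 < B.
  by apply: mulr_gt0 => //; apply: mulr_gt0.
have -> : 2 `^ sigma * (2 * M) * C ^+ midx_abs (a + b)%R * factorial_weight a b =
    2 `^ sigma * B by rewrite /B /P !mulrA.
have powm j N : `|int_vec R k 0 j| ^+ N * Q <= B * C ^+ N * N`!%:R `^ sigma.
  (* the multi-index N e_j selects the N-th power of the j-th coordinate *)
  pose c : 'rV[nat]_m := \row_i (if i == j then N else 0%N).
  have cj (x0 : nat) (op : Monoid.com_law x0) (F : nat -> nat) : F 0%N = x0 ->
      \big[op/x0]_(i < m) F (c ord0 i) = F N.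
    move=> F0; rewrite (bigD1 j)//= mxE eqxx big1 ?Monoid.mulm1// => i /negPf ij.
    by rewrite mxE ij.
  have := mom c.
  have -> : midx_abs c = N by exact: (cj _ addn id).
  have -> : midx_fact c = N`! by exact: (cj _ muln factorial).
  have -> : \prod_i `|int_vec R k 0 i| ^+ c 0 i = `|int_vec R k 0 j| ^+ N.
    have cE i : c 0 i = if i == j then N else 0%N by rewrite mxE.
    rewrite (bigD1 j)//= cE eqxx big1 ?mulr1// => i /negPf ij.
    by rewrite cE ij expr0.
  move=> h; apply: (le_trans h); rewrite exprD /B /P.
  move: (N`!%:R `^ sigma) (factorial_weight a b) (C ^+ midx_abs (a + b)%R).
  by move: (C ^+ N) => y1 y2 y3 y4; rewrite le_eqVlt; apply/orP; left; apply/eqP; ring.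
(* for k = 0, which includes m = 0, the multi-index c = 0 suffices *)
have [k0|/rV0Pn[j0 _]] := eqVneq k 0.
  have -> : int_vec R k = 0 by apply/rowP => j; rewrite k0 !mxE.
  rewrite eucl_norm0 powR0 ?gt_eqF// mulr0 expR0 mul1r.
  have c0 j : (0 : 'rV[nat]_m) 0 j = 0%N by rewrite mxE.
  have := mom 0; rewrite big1 => [|j _]; last by rewrite c0 expr0.
  have -> : midx_abs (0 : 'rV[nat]_m) = 0%N by rewrite /midx_abs big1// => j _; rewrite mxE.
  have -> : midx_fact (0 : 'rV[nat]_m) = 1%N by rewrite /midx_fact big1// => j _; rewrite mxE.
  rewrite mul1r addn0 powR1 mulr1 mulrA -/P -/B => /le_trans; apply.
  rewrite ler_peMl ?(ltW B0)// -[leLHS](powRr0 2).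
  by apply: ler_powR; [rewrite ler1n|exact: ltW].
have [j _ jmax] := @arg_maxP _ _ _ j0 predT (fun i => `|int_vec R k 0 i|) isT.
have y0 : 0 <= `|int_vec R k 0 j| by [].
apply: le_trans (expR_decay_of_moments sigma_gt0 C0 y0 Q0 (powm j)).
rewrite ler_wpM2r// ler_expR -/r.
set h := sigma / 2 * C^-1 `^ r.
have h0 : 0 <= h by rewrite mulr_ge0 ?powR_ge0// divr_ge0// ltW.
rewrite -mulrA ler_wpM2l// ler_pdivrMl ?powR_gt0// -powRM//.
apply: (ge0_ler_powR (ltW r0)).
- exact: eucl_norm_ge0.
- by rewrite nnegrE mulr_ge0.
apply: (le_trans (ler_eucl_norm_coord (j := j) _)); first by move=> i; exact: jmax.
by rewrite ler_wpM2r// ler_nat.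
Qed.

Lemma GS_of_fourier_bound f (C0 C1 eps : R) : smooth_torus f ->
  0 < C0 -> 0 < C1 -> 0 < eps -> fourier_bound f C0 C1 eps ->
  exists M C, [/\ 0 < M, 0 < C & GS_bound f M C].
Proof.
move=> sm C00 C10 eps0 fb.
set r := 1 / sigma; have r0 : 0 < r by rewrite divr_gt0.
have d0 : 0 < eps / m.+1%:R by rewrite divr_gt0// ltr0n.
have [K [D [K0 D0 KD]]] := moments_of_expR_decay sigma_ge1 d0.
exists (2 * 2 ^+ m * K ^+ m * C0), (C1 + D); split.
- by rewrite !mulr_gt0 ?exprn_gt0.
- by rewrite addr_gt0.
move=> a b c [u x].
set F := mderive _ b _.
pose B := C0 * C1 ^+ midx_abs (a + b)%R * factorial_weight a b.
have B0 : 0 < B by rewrite !mulr_gt0 ?exprn_gt0 ?factorial_weight_gt0.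
pose A := B * (K ^+ m * D ^+ midx_abs c * (midx_fact c)%:R `^ sigma).
have A0 : 0 <= A.
  apply: mulr_ge0; first exact: ltW.
  by rewrite mulr_ge0 ?powR_ge0// mulr_ge0// exprn_ge0// ltW.
have AE : A = B * \prod_(j < m) (K * D ^+ c ord0 j * (c ord0 j)`!%:R `^ sigma).
  rewrite /A; congr (_ * _); rewrite !big_split/= prodr_const card_ord prodrXr.
  congr (_ * _); apply: (big_morph (fun k : nat => k%:R `^ sigma)).
    by move=> y1 y2; rewrite natrM powRM.
  by rewrite powR1.
have smF : smooth_torus F.
  by apply: smooth_torus_mderive_x; exact: smooth_torus_mderive_t.
apply: (@le_trans _ _ (2 * (A * 2 ^+ m))).
  apply: (@ler_normc_of_fourier _ _ (fun v => (monom x a)%:C * F (v, x)) u A) => //.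
  - exact: ccontinuous_monom_mderive.
  - move=> j v; congr (_ * _); have [per _] := smF.
    by rewrite -(per j (v, x)); congr F; congr pair => /=; rewrite scaler0 addr0.
  - move=> l; have T0 : 0 < (2 * pi) ^+ m :> R by rewrite exprn_gt0// twopi_gt0.
    rewrite -ler_pdivrMl//.
    have := congr1 (@Normc.normc R) (monom_fourier_coef a b c l x sm).
    rewrite [RHS]Normc.normcM normcR ger0_norm ?invr_ge0 ?(ltW T0)// => <-.
    rewrite Normc.normcM normc_prod_imag.
    have := fb a b l x; set Q := Normc.normc _; rewrite -/B => fbQ.
    have E0 : 0 < expR (eps * eucl_norm (int_vec R l) `^ r) by exact: expR_gt0.
    rewrite -(ler_pM2l E0) mulrCA.
    apply: (@le_trans _ _ ((\prod_j `|int_vec R l 0 j| ^+ c 0 j) * B)).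
      by rewrite ler_wpM2l// prodr_ge0// => j _; rewrite exprn_ge0.
    rewrite AE mulrC -mulrA mulrCA ler_wpM2l ?(ltW B0)// -big_split/=.
    apply: (@le_trans _ _ ((\prod_j expR (eps / m.+1%:R * `|int_vec R l 0 j| `^ r)) *
        \prod_(j < m) (K * D ^+ c ord0 j * (c ord0 j)`!%:R `^ sigma * weight (l 0 j)))).
      rewrite -big_split/=; apply: ler_prod => j _; rewrite exprn_ge0//=.
      have lj : `|int_vec R l 0 j| = `|l 0 j|%:R by rewrite mxE natr_absz intr_norm.
      rewrite /weight -lj mulrA mulrC.
      rewrite ler_pdivlMl; last by rewrite mulr_gt0// ltr_wpDl.
      by rewrite mulrC [leRHS]mulrC; apply: KD.
    apply: ler_wpM2r; last exact: prod_expR_eucl_norm.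
    apply: prodr_ge0 => j _; rewrite !mulr_ge0 ?weight_ge0 ?powR_ge0 ?exprn_ge0//; exact: ltW.
have W0 : 0 <= (midx_fact c)%:R `^ sigma * factorial_weight a b.
  by rewrite mulr_ge0 ?powR_ge0.
have CD : C1 ^+ midx_abs (a + b)%R * D ^+ midx_abs c <=
    (C1 + D) ^+ (midx_abs (a + b)%R + midx_abs c).
  rewrite exprD ler_pM ?exprn_ge0 ?(ltW C10) ?(ltW D0)// lerXn2r ?nnegrE ?addr_ge0 ?ltW//.
    by rewrite ltrDl.
  by rewrite ltrDr.
have M0 : 0 <= 2 * 2 ^+ m * K ^+ m * C0 by rewrite !mulr_ge0 ?exprn_ge0 ?ltW.
rewrite -[X in _ <= _ * X]mulrA.
apply: le_trans (ler_wpM2l M0 (ler_wpM2r W0 CD)).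
rewrite /A /B; move: ((midx_fact c)%:R `^ sigma) (factorial_weight a b).
move: (C1 ^+ midx_abs (a + b)%R) (D ^+ midx_abs c) (K ^+ m) (2 ^+ m : R).
by move=> y1 y2 y3 y4 y5 y6; rewrite le_eqVlt; apply/orP; left; apply/eqP; ring.
Qed.

End characterization.

Unset Implicit Arguments.
Set Strict Implicit.

Theorem proposition3p4 (R : realType) (m n : nat) (sigma mu : R)
    (hsigma : 1 <= sigma) (hmu : 1 / 2 <= mu)
    (f : 'rV[R]_m * 'rV[R]_n -> R[i])
    (hf : (@smooth_torus R m n `&` @L1_torus R m n) f) :
  GS_space sigma mu f <->
  exists C0 C1 eps : R, [/\ 0 < C0, 0 < C1, 0 < eps &
    forall a b : 'rV[nat]_n,
      (ereal_sup (range (fun kx : 'rV[int]_m * 'rV[R]_n =>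
         (expR (eps * eucl_norm (int_vec R kx.1) `^ (1 / sigma)) *
          Normc.normc ((monom kx.2 a)%:C *
            mderive (fun i : 'I_n => delta_mx 0 i) b
              (fourier_coef f kx.1) kx.2))%:E))
       <= (C0 * C1 ^+ midx_abs (a + b)
             * (midx_fact a * midx_fact b)%:R `^ mu)%:E)%E].
Proof.
have [sm _] := hf; split.
  move=> [C C0 /(GS_space_constP sigma mu f C0)[_ [M M0 fM]]].
  have s0 : 0 < sigma by exact: lt_le_trans hsigma.
  exists (2 `^ sigma * (2 * M)), C,
    (sigma / 2 * C^-1 `^ (1 / sigma) / m.+1%:R `^ (1 / sigma)); split => //.
  - by rewrite !mulr_gt0// powR_gt0.
  - by rewrite !(mulr_gt0, divr_gt0, invr_gt0, powR_gt0).
  - move=> a b; apply: ge_ereal_sup => _ [[k x] _ <-]; rewrite lee_fin.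
    exact: (fourier_bound_of_GS hsigma sm M0 C0 fM).
move=> [C0 [C1 [eps [C00 C10 eps0 fb]]]].
have [|M [C [M0 Cp fM]]] := GS_of_fourier_bound hsigma (mu := mu) sm C00 C10 eps0.
  move=> a b k x; rewrite -lee_fin; apply: le_trans (fb a b).
  by apply: ereal_sup_ubound; exists (k, x).
by exists C => //; apply/(GS_space_constP sigma mu f Cp); split => //; exists M.
Qed.
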